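(* For any finite simplicial complex $K$, $$H^*\big(T^*(N(K)),\Delta\big)\cong H^*(K),\qquad H_*\big(T_*(N(K)),D\big)\cong H_*(K),$$ and $$H^*\big(T^*(\widetilde N(K)),\Delta\big)\cong\mathbb{Z},\qquad H_*\big(T_*(\widetilde N(K)),D\big)\cong\mathbb{Z}.$$
   Context: A (finite, abstract) simplicial complex $K$ with finite vertex set $S$ is a collection of subsets of $S$ (simplices) containing every $\{v\}$, $v\in S$, and closed under passing to subsets; in particular $\varnothing\in K$. $|\sigma|$ denotes the cardinality of $\sigma$ and $\dim\sigma=|\sigma|-1$. $H_*(K)$ and $H^*(K)$ are the usual simplicial homology and cohomology of $K$ with coefficients in $\mathbb{Z}$. $C_n(K)=C^n(K)$ ($n\ge 0$) is the group of oriented simplicial $n$-chains: generated by ordered sequences $(v_0,\dots,v_n)$ of vertices, alternating in the entries, and zero if an entry is repeated or $\{v_0,\dots,v_n\}\notin K$. $C_{-1}(K)=\mathbb{Z}$ is generated by $(\varnothing)$. $C_*(K)=C^*(K)=\bigoplus_{k\ge0}C_k(K)$ carries the usual simplicial boundary $d$ (zero on $C_0$) and the coboundary $\delta(v_0,\dots,v_k)=\sum_{v\in S}(v,v_0,\dots,v_k)$. $\widetilde C_*(K)=\widetilde C^*(K)=\bigoplus_{k\ge-1}C_k(K)$ carries the same operators with $d(v)=(\varnothing)$ and $\delta(\varnothing)=\sum_{v\in S}(v)$. $N^{p,q}(K)\subset C_p(K)\otimes C^q(K)$ is the subgroup generated by all $\sigma\otimes\tau$ with $\sigma\subset\tau$,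 with differential $\Delta(\sigma\otimes\tau)=(d\sigma)\otimes\tau+(-1)^{|\sigma|}\sigma\otimes(\delta\tau)$. Its total complex is $T^n(N(K))=\bigoplus_{q-p=n}N^{p,q}(K)$ with $\Delta\colon T^n\to T^{n+1}$. $\widetilde N^{p,q}(K)\subset\widetilde C_p(K)\otimes\widetilde C^q(K)$ (with $p,q\ge-1$) and its total complex are defined in the same way from the reduced complexes. $N_{p,q}(K)=\mathrm{Hom}(N^{p,q}(K),\mathbb{Z})$ with the dual differential $D=\Delta^*$, and $T_n(N(K))=\bigoplus_{q-p=n}N_{p,q}(K)$ with $D\colon T_n\to T_{n-1}$; likewise for $\widetilde N_{p,q}(K)$ and $T_*(\widetilde N(K))$. The first two isomorphisms are isomorphisms of graded groups; in the last two, $\mathbb{Z}$ is the total (co)homology group. *)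

(* Defs.v *)
From HB Require Import structures.
From mathcomp Require Import all_boot all_order all_algebra.
From mathcomp Require Import boolp functions.
From mathcomp Require Import zify.
From mathcomp Require freeg.

Set Implicit Arguments.
Unset Strict Implicit.
Unset Printing Implicit Defensive.

Import Order.TTheory GRing.Theory Num.Theory.
Import freeg.FreegDefs.Exports freeg.FreegZmodType.Exports.

Local Open Scope ring_scope.
Local Open Scope quotient_scope.

Definition zmod_iso (V W : zmodType) : Prop :=
  exists f : {additive V -> W}, bijective f.

Inductive generated (V : zmodType) (G : V -> Prop) : V -> Prop :=
| generated0 : generated G 0
| generated_mem x : G x -> generated G x
| generatedB x y : generated G x -> generated G y -> generated G (x - y).

Definition span (V : zmodType) (G : V -> Prop) : {pred V} :=
  fun x => `[< generated G x >].

Section Span.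
Variables (V : zmodType) (G : V -> Prop).

Lemma span_zmod_closed : zmod_closed (span G).
Proof.
split=> [|x y /asboolP xG /asboolP yG]; apply/asboolP.
  exact: generated0.
exact: generatedB.
Qed.
HB.instance Definition _ := GRing.isZmodClosed.Build V (span G) span_zmod_closed.

Lemma mem_span x : G x -> x \in span G.
Proof. by move=> Gx; apply/asboolP; apply: generated_mem. Qed.

Lemma span_ind (P : V -> Prop) :
  P 0 -> (forall x, G x -> P x) -> (forall x y, P x -> P y -> P (x - y)) ->
  forall x, x \in span G -> P x.
Proof. by move=> P0 PG PB x /asboolP; elim=> // *; auto. Qed.

Lemma span_sub (H : zmodClosed V) :
  (forall x, G x -> x \in H) -> forall x, x \in span G -> x \in H.
Proof.
by move=> GH; apply: span_ind => // [|x y]; [exact: rpred0|exact: rpredB].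
Qed.

Lemma span_additive_eq (W : zmodType) (f g : {additive V -> W}) :
  (forall x, G x -> f x = g x) -> forall x, x \in span G -> f x = g x.
Proof.
by move=> fg; apply: span_ind => // [|x y fx fy]; rewrite ?raddf0 // !raddfB fx fy.
Qed.

Lemma span_additive (W : zmodType) (H : zmodClosed W) (f : {additive V -> W}) :
  (forall x, G x -> f x \in H) -> forall x, x \in span G -> f x \in H.
Proof.
move=> fH; apply: span_ind => // [|x y fx fy]; first by rewrite raddf0 rpred0.
by rewrite raddfB rpredB.
Qed.

End Span.

Definition subgrp (V : zmodType) (H : zmodClosed V) := {x : V | x \in H}.

Section Subgrp.
Variables (V : zmodType) (H : zmodClosed V).
HB.instance Definition _ := SubChoice.on (subgrp H).
HB.instance Definition _ := [SubChoice_isSubZmodule of subgrp H by <:].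
End Subgrp.

Definition restr (V : zmodType) (H : zmodClosed V) (f : V -> V)
    (fH : forall x, x \in H -> f x \in H) (x : subgrp H) : subgrp H :=
  exist _ (f (val x)) (fH _ (valP x)).

Section Restr.
Variables (V : zmodType) (H : zmodClosed V) (f : {additive V -> V}).
Hypothesis fH : forall x, x \in H -> f x \in H.
Lemma restr_is_zmod_morphism : zmod_morphism (restr fH).
Proof. by move=> x y; apply: val_inj; rewrite /= !raddfB. Qed.
HB.instance Definition _ :=
  GRing.isZmodMorphism.Build (subgrp H) (subgrp H) (restr fH)
  restr_is_zmod_morphism.
End Restr.

Definition preim_add (V W : zmodType) (f : {additive V -> W}) (H : {pred W}) :
    {pred V} := fun x => f x \in H.

Section PreimAdd.
Variables (V W : zmodType) (f : {additive V -> W}) (H : zmodClosed W).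
Lemma preim_zmod_closed : zmod_closed (preim_add f H).
Proof.
split=> [|x y xH yH]; rewrite unfold_in ?raddf0 ?rpred0 //.
by rewrite raddfB; apply: rpredB.
Qed.
HB.instance Definition _ :=
  GRing.isZmodClosed.Build V (preim_add f H) preim_zmod_closed.
End PreimAdd.

Definition quot_equiv (V : zmodType) (H : zmodClosed V) : rel V :=
  fun x y => x - y \in H.

Section Quot.
Variables (V : zmodType) (H : zmodClosed V).

Lemma quot_equivxx : reflexive (quot_equiv H).
Proof. by move=> x; rewrite /quot_equiv subrr rpred0. Qed.
Lemma quot_equivC : symmetric (quot_equiv H).
Proof. by move=> x y; rewrite /quot_equiv -opprB rpredN. Qed.
Lemma quot_equiv_trans : transitive (quot_equiv H).
Proof.
move=> y x z xy yz; rewrite /quot_equiv -(subrK y x) -addrA.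
exact: rpredD.
Qed.

Canonical quot_equiv_rel :=
  EquivRel (quot_equiv H) quot_equivxx quot_equivC quot_equiv_trans.
Canonical quot_enc_mod_rel := defaultEncModRel (quot_equiv H).

Definition quot := {eq_quot (quot_equiv H)}.
HB.instance Definition _ : EqQuotient V (quot_equiv H) quot :=
  EqQuotient.on quot.
HB.instance Definition _ := Choice.on quot.

Definition proj (x : V) : quot := \pi_quot x.

Lemma projP x y : (proj x = proj y) <-> (x - y \in H).
Proof. by split=> [/eqmodP|xy]; [|apply/eqmodP]. Qed.

Lemma proj_repr (a : quot) : proj (repr a) = a.
Proof. exact: reprK. Qed.

Let qadd (a b : quot) := proj (repr a + repr b).
Let qopp (a : quot) := proj (- repr a).

Let qaddE x y : qadd (proj x) (proj y) = proj (x + y).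
Proof.
apply/projP; rewrite opprD addrACA; apply: rpredD; apply/projP; exact: proj_repr.
Qed.
Let qoppE x : qopp (proj x) = proj (- x).
Proof. by apply/projP; rewrite -opprD rpredN; apply/projP/proj_repr. Qed.

Let qaddA : associative qadd.
Proof.
move=> a b c; rewrite -(proj_repr a) -(proj_repr b) -(proj_repr c).
by rewrite !qaddE addrA.
Qed.
Let qaddC : commutative qadd.
Proof. by move=> a b; rewrite /qadd addrC. Qed.
Let qadd0 : left_id (proj 0) qadd.
Proof. by move=> a; rewrite -(proj_repr a) qaddE add0r. Qed.
Let qaddN : left_inverse (proj 0) qopp qadd.
Proof. by move=> a; rewrite -(proj_repr a) qoppE qaddE addNr. Qed.

HB.instance Definition _ := GRing.isZmodule.Build quot qaddA qaddC qadd0 qaddN.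

Lemma proj_is_zmod_morphism : zmod_morphism proj.
Proof.
by move=> x y; rewrite -qaddE -qoppE.
Qed.
HB.instance Definition _ :=
  GRing.isZmodMorphism.Build V quot proj proj_is_zmod_morphism.

Lemma proj_eq0 x : (proj x = 0) <-> (x \in H).
Proof. by rewrite -(raddf0 proj) projP subr0. Qed.

Definition quot_lift (W : zmodType) (f : {additive V -> W})
  (fH : forall x, x \in H -> f x = 0) (a : quot) : W := f (repr a).

Section QuotLift.
Variables (W : zmodType) (f : {additive V -> W}).
Hypothesis fH : forall x, x \in H -> f x = 0.

Lemma quot_liftE x : quot_lift fH (proj x) = f x.
Proof.
by apply/eqP; rewrite /quot_lift -subr_eq0 -raddfB fH //; apply/projP/proj_repr.
Qed.

Lemma quot_lift_is_zmod_morphism : zmod_morphism (quot_lift fH).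
Proof.
move=> a b; rewrite -(proj_repr a) -(proj_repr b) -raddfB !quot_liftE.
by rewrite raddfB.
Qed.
HB.instance Definition _ :=
  GRing.isZmodMorphism.Build quot W (quot_lift fH) quot_lift_is_zmod_morphism.
End QuotLift.

End Quot.

Section FreeLift.
Variables (X : choiceType) (W : zmodType) (f : X -> W).

Definition free_gen (x : X) : {freeg X} := freeg.Freeg [:: (1, x)].

Definition free_lift (D : {freeg X}) : W :=
  freeg.fglift (f : X -> zmodule W) D.

Lemma free_lift_is_zmod_morphism : zmod_morphism free_lift.
Proof. exact: (freeg.lift_is_additive (f : X -> zmodule W)). Qed.
HB.instance Definition _ := GRing.isZmodMorphism.Build {freeg X} W free_lift
  free_lift_is_zmod_morphism.

Lemma free_liftE x : free_lift (free_gen x) = f x.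
Proof. by rewrite /free_lift freeg.liftU. Qed.
End FreeLift.

Lemma free_ind (X : choiceType) (H : zmodClosed {freeg X}) :
  (forall x, free_gen x \in H) -> forall D, D \in H.
Proof.
move=> HX D; rewrite -(freeg.freeg_sumE D); apply: rpred_sum => x _.
have -> : freeg.Freeg [:: (freeg.coeff x D, x)] = free_gen x *~ freeg.coeff x D.
  by rewrite freeg.freegU_mulz intz.
exact: rpredMz.
Qed.

Section Presented.
Variables (X : choiceType) (R : {freeg X} -> Prop).

Definition presented : zmodType := quot (span R).

Definition gen (x : X) : presented := proj (span R) (free_gen x).

Lemma gen_rel D : R D -> proj (span R) D = 0.
Proof. by move=> RD; apply/proj_eq0/mem_span. Qed.

Lemma presented_ind (H : zmodClosed presented) :
  (forall x, gen x \in H) -> forall a, a \in H.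
Proof.
move=> HX a; rewrite -(proj_repr a).
have := @free_ind X (preim_add (proj (span R)) H); apply => x.
by rewrite unfold_in /preim_add HX.
Qed.

Lemma presented_additive_eq (W : zmodType) (f g : {additive presented -> W}) :
  (forall x, f (gen x) = g (gen x)) -> f =1 g.
Proof.
move=> fg a; apply: (@span_additive_eq presented (fun a => exists x, a = gen x)).
  by move=> _ [x ->].
by apply: presented_ind => x; apply: mem_span; exists x.
Qed.

Section Lift.
Variables (W : zmodType) (f : X -> W).
Hypothesis fR : forall D, R D -> free_lift f D = 0.

Lemma presented_lift_subproof x : x \in span R -> free_lift f x = 0.
Proof.
move: x; apply: span_ind => // [|x y fx fy]; first by rewrite raddf0.
by rewrite raddfB /= fx fy subr0.
Qed.

Definition presented_lift : presented -> W :=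
  quot_lift presented_lift_subproof.
HB.instance Definition _ := GRing.isZmodMorphism.Build presented W
  presented_lift (quot_lift_is_zmod_morphism presented_lift_subproof).

Lemma presented_liftE x : presented_lift (gen x) = f x.
Proof. by rewrite -(free_liftE f); apply: quot_liftE. Qed.
End Lift.

End Presented.

Section Tensor.
Variables A B : zmodType.

Inductive bilinear_rel : {freeg (A * B)} -> Prop :=
| bilinear_l a a' b : bilinear_rel
    (free_gen (a + a', b) - free_gen (a, b) - free_gen (a', b))
| bilinear_r a b b' : bilinear_rel
    (free_gen (a, b + b') - free_gen (a, b) - free_gen (a, b')).

Definition tensor : zmodType := presented bilinear_rel.
Definition tens (a : A) (b : B) : tensor := gen bilinear_rel (a, b).

Lemma tensDl (a a' : A) (b : B) : tens (a + a') b = tens a b + tens a' b.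
Proof.
have /gen_rel/eqP := bilinear_l a a' b.
by rewrite !raddfB /= !subr_eq add0r => /eqP e; rewrite [RHS]addrC; apply: e.
Qed.

Lemma tensDr (a : A) (b b' : B) : tens a (b + b') = tens a b + tens a b'.
Proof.
have /gen_rel/eqP := bilinear_r a b b'.
by rewrite !raddfB /= !subr_eq add0r => /eqP e; rewrite [RHS]addrC; apply: e.
Qed.

Lemma tens_is_zmod_morphism_l b : zmod_morphism (tens^~ b).
Proof.
by move=> a a'; apply/eqP; rewrite eq_sym subr_eq -tensDl subrK.
Qed.
Lemma tens_is_zmod_morphism_r a : zmod_morphism (tens a).
Proof.
by move=> b b'; apply/eqP; rewrite eq_sym subr_eq -tensDr subrK.
Qed.
HB.instance Definition _ a :=
  GRing.isZmodMorphism.Build B tensor (tens a) (tens_is_zmod_morphism_r a).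

Definition tensl (b : B) (a : A) : tensor := tens a b.
HB.instance Definition _ b :=
  GRing.isZmodMorphism.Build A tensor (tensl b) (tens_is_zmod_morphism_l b).

Section TensorLift.
Variables (W : zmodType) (f : A -> B -> W).
Hypothesis fDl : forall b, zmod_morphism (f^~ b).
Hypothesis fDr : forall a, zmod_morphism (f a).

Lemma tensor_lift_subproof D :
  bilinear_rel D -> free_lift (fun ab => f ab.1 ab.2) D = 0.
Proof.
case=> [a a' b|a b b']; rewrite !raddfB /= !free_liftE /=.
  by rewrite -(fDl b) addrAC subrr add0r subrr.
by rewrite -(fDr a) addrAC subrr add0r subrr.
Qed.

Definition tensor_lift : tensor -> W := presented_lift tensor_lift_subproof.
HB.instance Definition _ := GRing.isZmodMorphism.Build tensor W
  tensor_lift (raddfB (presented_lift tensor_lift_subproof)).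

Lemma tensor_liftE a b : tensor_lift (tens a b) = f a b.
Proof. exact: presented_liftE. Qed.
End TensorLift.

Lemma tensor_additive_eq (W : zmodType) (f g : {additive tensor -> W}) :
  (forall a b, f (tens a b) = g (tens a b)) -> f =1 g.
Proof. by move=> fg; apply: presented_additive_eq => -[a b]; apply: fg. Qed.

End Tensor.

Section TensorMap.
Variables (A B A' B' : zmodType).
Variables (f : {additive A -> A'}) (g : {additive B -> B'}).

Lemma tensor_map_subproof_l b : zmod_morphism (fun a => tens (f a) (g b)).
Proof. by move=> a a'; rewrite raddfB tens_is_zmod_morphism_l. Qed.
Lemma tensor_map_subproof_r a : zmod_morphism (fun b => tens (f a) (g b)).
Proof. by move=> b b'; rewrite !raddfB. Qed.

Definition tensor_map : tensor A B -> tensor A' B' :=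
  tensor_lift tensor_map_subproof_l tensor_map_subproof_r.
HB.instance Definition _ := GRing.isZmodMorphism.Build
  (tensor A B) (tensor A' B') tensor_map
  (raddfB (tensor_lift tensor_map_subproof_l tensor_map_subproof_r)).

Lemma tensor_mapE a b : tensor_map (tens a b) = tens (f a) (g b).
Proof. exact: tensor_liftE. Qed.
End TensorMap.

Definition zmod_morphism_pred (V W : zmodType) : {pred V -> W} :=
  fun f => `[< zmod_morphism f >].

Section Hom.
Variables V W : zmodType.

Lemma zmod_morphism_zmod_closed : zmod_closed (@zmod_morphism_pred V W).
Proof.
split=> [|f g /asboolP fB /asboolP gB]; apply/asboolP => x y.
  by rewrite subr0.
change (f (x - y) - g (x - y) = (f x - g x) - (f y - g y)).
by rewrite fB gB !opprB [g y - g x]addrC addrACA [- f y + g y]addrC.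
Qed.
HB.instance Definition _ := GRing.isZmodClosed.Build (V -> W)
  (@zmod_morphism_pred V W) zmod_morphism_zmod_closed.

Definition Hom : zmodType := subgrp (@zmod_morphism_pred V W).

Definition app (phi : Hom) : V -> W := val phi.

Lemma app_is_zmod_morphism phi : zmod_morphism (app phi).
Proof. exact/asboolP/(valP phi). Qed.
HB.instance Definition _ phi :=
  GRing.isZmodMorphism.Build V W (app phi) (app_is_zmod_morphism phi).

Lemma Hom_subproof (f : {additive V -> W}) :
  (f : V -> W) \in @zmod_morphism_pred V W.
Proof. by apply/asboolP; apply: raddfB. Qed.
Definition hom (f : {additive V -> W}) : Hom := exist _ (f : V -> W) (Hom_subproof f).

Lemma homP (phi psi : Hom) : app phi =1 app psi -> phi = psi.
Proof. by move=> e; apply/val_inj/funext. Qed.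
End Hom.

Section Precomp.
Variables (U V W : zmodType) (f : {additive U -> V}).
Definition precomp (phi : Hom V W) : Hom U W := hom (app phi \o f).
Lemma precomp_is_zmod_morphism : zmod_morphism precomp.
Proof. by move=> phi psi; apply: homP. Qed.
HB.instance Definition _ := GRing.isZmodMorphism.Build (Hom V W) (Hom U W)
  precomp precomp_is_zmod_morphism.
End Precomp.
Arguments precomp {U V} W f phi.

Definition dprod (I : Type) (A : I -> zmodType) := forall i, A i.

Section Dprod.
Variables (I : Type) (A : I -> zmodType).
HB.instance Definition _ := gen_eqMixin (dprod A).
HB.instance Definition _ := gen_choiceMixin (dprod A).
Let add (f g : dprod A) : dprod A := fun i => f i + g i.
Let opp (f : dprod A) : dprod A := fun i => - f i.
Let zero : dprod A := fun i => 0.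
Let addA : associative add.
Proof. by move=> f g h; apply: functional_extensionality_dep => i; apply: addrA. Qed.
Let addC : commutative add.
Proof. by move=> f g; apply: functional_extensionality_dep => i; apply: addrC. Qed.
Let add0 : left_id zero add.
Proof. by move=> f; apply: functional_extensionality_dep => i; apply: add0r. Qed.
Let addN : left_inverse zero opp add.
Proof. by move=> f; apply: functional_extensionality_dep => i; apply: addNr. Qed.
HB.instance Definition _ := GRing.isZmodule.Build (dprod A) addA addC add0 addN.
End Dprod.

Definition finsupp (I : eqType) (A : I -> zmodType) : {pred dprod A} :=
  fun f => `[< exists s : seq I, forall i, i \notin s -> f i = 0 >].

Section Dsum.
Variables (I : eqType) (A : I -> zmodType).
Lemma finsupp_zmod_closed : zmod_closed (@finsupp I A).
Proof.
split=> [|f g /asboolP[s fs] /asboolP[t gt]]; apply/asboolP.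
  by exists [::].
exists (s ++ t) => i; rewrite mem_cat negb_or => /andP[/fs fi /gt gi].
by rewrite -[(f - g) i]/(f i - g i) fi gi subr0.
Qed.
HB.instance Definition _ := GRing.isZmodClosed.Build (dprod A) (@finsupp I A)
  finsupp_zmod_closed.
Definition dsum : zmodType := subgrp (@finsupp I A).
End Dsum.

(* A graded complex given by its total group and the subgroups of homogeneous
   elements; the differential has degree [e]. *)
Record complex (e : int) := Complex {
  cgrp : zmodType;
  cpart : int -> zmodClosed cgrp;
  cdiff : {additive cgrp -> cgrp};
  cdiff_part n x : x \in cpart n -> cdiff x \in cpart (n + e);
  cdiffK x : cdiff (cdiff x) = 0
}.

Definition is_cycle e (X : complex e) (n : int) : {pred cgrp X} :=
  fun x => (x \in cpart X n) && (cdiff X x == 0).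
Arguments is_cycle {e} X n _.

Section Cycles.
Variables (e : int) (X : complex e) (n : int).
Lemma is_cycle_zmod_closed : zmod_closed (is_cycle X n).
Proof.
split=> [|x y /andP[xn /eqP dx] /andP[yn /eqP dy]]; apply/andP; split.
- exact: rpred0.
- by rewrite raddf0.
- exact: rpredB.
- by rewrite raddfB dx dy subrr.
Qed.
HB.instance Definition _ := GRing.isZmodClosed.Build (cgrp X) (is_cycle X n)
  is_cycle_zmod_closed.
Definition cycles : zmodType := subgrp (is_cycle X n).
End Cycles.

Definition is_boundary e (X : complex e) (n : int) : {pred cycles X n} :=
  fun z => `[< exists2 y, y \in cpart X (n - e) & val z = cdiff X y >].
Arguments is_boundary {e} X n _.

Section Homology.
Variables (e : int) (X : complex e) (n : int).
Lemma is_boundary_zmod_closed : zmod_closed (is_boundary X n).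
Proof.
split=> [|z z' /asboolP[y yn zE] /asboolP[y' yn' zE']]; apply/asboolP.
  by exists 0; rewrite ?rpred0 ?raddf0.
by exists (y - y'); rewrite ?rpredB // !raddfB /= zE zE'.
Qed.
HB.instance Definition _ := GRing.isZmodClosed.Build (cycles X n)
  (is_boundary X n) is_boundary_zmod_closed.
Definition homology : zmodType := quot (is_boundary X n).
End Homology.

Record simplicial_complex (S : finType) := SimplicialComplex {
  simplices :> {set {set S}};
  simplices_vertex (v : S) : [set v] \in simplices;
  simplices_empty : set0 \in simplices;
  simplices_sub (s t : {set S}) :
    t \in simplices -> s \subset t -> s \in simplices
}.

Section Chains.
Variables (S : finType) (K : simplicial_complex S).
Implicit Types (s t u v : seq S) (x y : S).

Definition spans_simplex s : bool := uniq s && ([set x in s] \in simplices K).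

(* Transposing adjacent entries generates all permutations of a sequence, so
   [chain_swap] is the alternation rule. *)
Inductive chain_rel : {freeg (seq S)} -> Prop :=
| chain_swap u x y v : chain_rel
    (free_gen (u ++ x :: y :: v) + free_gen (u ++ y :: x :: v))
| chain_null s : ~~ spans_simplex s -> chain_rel (free_gen s).

(* The relations are homogeneous in the length of the sequences, and the empty
   sequence is a generator, so this is the direct sum of the C_k(K), k >= -1.
   The unreduced complex uses the same ambient group, but only its direct
   summands with k >= 0; see [has_dim]. *)
Definition chains : zmodType := presented chain_rel.

Definition osimplex s : chains := gen chain_rel s.

Lemma osimplex_swap u x y v :
  osimplex (u ++ x :: y :: v) = - osimplex (u ++ y :: x :: v).
Proof.
have /gen_rel/eqP := chain_swap u x y v.
by rewrite raddfD /= addr_eq0 => /eqP.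
Qed.

Lemma osimplex_null s : ~~ spans_simplex s -> osimplex s = 0.
Proof. by move=> sN; apply/gen_rel/chain_null. Qed.

Lemma spans_simplex_perm s t : perm_eq s t -> spans_simplex s = spans_simplex t.
Proof.
move=> st; rewrite /spans_simplex (perm_uniq st).
suff -> : [set x in s] = [set x in t] by [].
by apply/setP => x; rewrite !inE (perm_mem st).
Qed.

Lemma spans_simplex_subseq s t :
  subseq s t -> spans_simplex t -> spans_simplex s.
Proof.
move=> st /andP[tU tK]; rewrite /spans_simplex (subseq_uniq st tU) /=.
apply: (simplices_sub tK); apply/subsetP => x; rewrite !inE; apply: (mem_subseq st).
Qed.

Lemma perm_swap u x y v : perm_eq (u ++ x :: y :: v) (u ++ y :: x :: v).
Proof. by rewrite perm_cat2l; apply/permP => P /=; rewrite addnCA. Qed.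

Section ChainLift.
Variables (W : zmodType) (f : seq S -> W).
Hypothesis f_swap : forall u x y v, f (u ++ x :: y :: v) = - f (u ++ y :: x :: v).
Hypothesis f_null : forall s, ~~ spans_simplex s -> f s = 0.

Lemma chain_lift_subproof D : chain_rel D -> free_lift f D = 0.
Proof.
case=> [u x y v|s sN]; last by rewrite free_liftE f_null.
by rewrite raddfD /= !free_liftE f_swap addNr.
Qed.

Definition chain_lift : chains -> W := presented_lift chain_lift_subproof.
HB.instance Definition _ := GRing.isZmodMorphism.Build chains W
  chain_lift (raddfB (presented_lift chain_lift_subproof)).

Lemma chain_liftE s : chain_lift (osimplex s) = f s.
Proof. exact: presented_liftE. Qed.
End ChainLift.

Lemma chains_additive_eq (W : zmodType) (f g : {additive chains -> W}) :
  (forall s, f (osimplex s) = g (osimplex s)) -> f =1 g.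
Proof. exact: presented_additive_eq. Qed.

Definition face (i : nat) s : seq S := take i s ++ drop i.+1 s.

Definition face_sum s : chains :=
  \sum_(i < size s) osimplex (face i s) *~ (-1) ^+ i.

(* [r] selects the reduced boundary ([true], d(v) = the empty simplex) or the
   unreduced one ([false], d = 0 on 0-chains). The guard [spans_simplex] is
   needed because the faces of a non-simplex need not vanish. *)
Definition boundary_gen (r : bool) s : chains :=
  if spans_simplex s && (r || (1 < size s)%N) then face_sum s else 0.

Definition coboundary_gen s : chains := \sum_(v : S) osimplex (v :: s).

Definition sign_gen s : chains := osimplex s *~ (-1) ^+ size s.

Lemma cone_swap x u y z v :
  osimplex (x :: u ++ y :: z :: v) = - osimplex (x :: u ++ z :: y :: v).
Proof. exact: (osimplex_swap (x :: u)). Qed.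

Lemma cone_null x s : ~~ spans_simplex s -> osimplex (x :: s) = 0.
Proof.
move=> sN; apply: osimplex_null; apply: contra sN.
exact/spans_simplex_subseq/subseq_cons.
Qed.

Definition cone x : chains -> chains := chain_lift (cone_swap x) (cone_null x).
HB.instance Definition _ x := GRing.isZmodMorphism.Build chains chains
  (cone x) (raddfB (chain_lift (cone_swap x) (cone_null x))).

Lemma coneE x s : cone x (osimplex s) = osimplex (x :: s).
Proof. exact: chain_liftE. Qed.

Lemma coneC x y a : cone x (cone y a) = - cone y (cone x a).
Proof.
pose f : {additive chains -> chains} := cone x \o cone y.
pose g : {additive chains -> chains} := -%R \o (cone y \o cone x).
have := @chains_additive_eq _ f g; apply => s /=.
by rewrite !coneE (osimplex_swap [::]).
Qed.

Lemma face_sum_cons x s : face_sum (x :: s) = osimplex s - cone x (face_sum s).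
Proof.
rewrite /face_sum /= big_ord_recl /= /face /= drop0 expr0 mulr1z; congr (_ + _).
rewrite raddf_sum -sumrN; apply: eq_bigr => i _.
by rewrite raddfMz /= coneE /bump /= add1n exprS mulN1r mulrNz.
Qed.

Lemma face_sum_swap u x y v :
  face_sum (u ++ x :: y :: v) = - face_sum (u ++ y :: x :: v).
Proof.
elim: u => [|z u IH] /=; last first.
  by rewrite !face_sum_cons IH raddfN osimplex_swap opprB opprK addrC.
rewrite !face_sum_cons (raddfB (cone x)) (raddfB (cone y)) /=.
rewrite !coneE (coneC x y).
by rewrite opprK opprD opprB addrA addrAC.
Qed.

Lemma boundary_swap r u x y v :
  boundary_gen r (u ++ x :: y :: v) = - boundary_gen r (u ++ y :: x :: v).
Proof.
rewrite /boundary_gen (spans_simplex_perm (perm_swap u x y v)).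
rewrite (perm_size (perm_swap u x y v)) face_sum_swap.
by case: ifP; rewrite ?oppr0.
Qed.

Lemma boundary_null r s : ~~ spans_simplex s -> boundary_gen r s = 0.
Proof. by rewrite /boundary_gen => /negPf->. Qed.

Lemma coboundary_swap u x y v :
  coboundary_gen (u ++ x :: y :: v) = - coboundary_gen (u ++ y :: x :: v).
Proof. by rewrite -sumrN; apply: eq_bigr => z _; apply: cone_swap. Qed.

Lemma coboundary_null s : ~~ spans_simplex s -> coboundary_gen s = 0.
Proof. by move=> sN; apply: big1 => z _; apply: cone_null. Qed.

Lemma sign_swap u x y v :
  sign_gen (u ++ x :: y :: v) = - sign_gen (u ++ y :: x :: v).
Proof.
by rewrite /sign_gen (perm_size (perm_swap u x y v)) osimplex_swap mulNrz.
Qed.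

Lemma sign_null s : ~~ spans_simplex s -> sign_gen s = 0.
Proof. by rewrite /sign_gen => /osimplex_null->; rewrite mul0rz. Qed.

Definition boundary (r : bool) : chains -> chains :=
  chain_lift (boundary_swap r) (boundary_null r).
HB.instance Definition _ r := GRing.isZmodMorphism.Build chains chains
  (boundary r) (raddfB (chain_lift (boundary_swap r) (boundary_null r))).

Definition coboundary : chains -> chains :=
  chain_lift coboundary_swap coboundary_null.
HB.instance Definition _ := GRing.isZmodMorphism.Build chains chains
  coboundary (raddfB (chain_lift coboundary_swap coboundary_null)).

Definition sign : chains -> chains := chain_lift sign_swap sign_null.
HB.instance Definition _ := GRing.isZmodMorphism.Build chains chains
  sign (raddfB (chain_lift sign_swap sign_null)).

Lemma boundaryE r s : boundary r (osimplex s) = boundary_gen r s.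
Proof. exact: chain_liftE. Qed.
Lemma coboundaryE s : coboundary (osimplex s) = coboundary_gen s.
Proof. exact: chain_liftE. Qed.
Lemma signE s : sign (osimplex s) = sign_gen s.
Proof. exact: chain_liftE. Qed.

Lemma size_face i s : (i < size s)%N -> size (face i s) = (size s).-1.
Proof.
move=> si; rewrite size_cat size_take size_drop si; lia.
Qed.

Lemma face_subseq i s : subseq (face i s) s.
Proof.
rewrite -[X in subseq _ X](cat_take_drop i s); apply: cat_subseq => //.
rewrite -[i.+1]add1n -drop_drop; exact: drop_subseq.
Qed.

Lemma face_face_sum s :
  \sum_(i < size s) face_sum (face i s) *~ (-1) ^+ i = 0.
Proof.
elim: s => [|x s IH]; first by rewrite big_ord0.
rewrite /= big_ord_recl /= {1}/face /= drop0 expr0 mulr1z.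
rewrite [X in _ + X](_ : _ = - face_sum s) ?subrr //.
transitivity (- (face_sum s -
    cone x (\sum_(i < size s) face_sum (face i s) *~ (-1) ^+ i))); last first.
  by rewrite IH raddf0 subr0.
rewrite raddf_sum /face_sum -sumrB -sumrN; apply: eq_bigr => i _.
rewrite raddfMz /= -[X in _ = - (X - _)]/(_ *~ _) -mulrzBl -mulrNz.
rewrite /bump /= add1n exprS mulN1r; congr (_ *~ _).
exact: face_sum_cons.
Qed.

Lemma boundaryK r a : boundary r (boundary r a) = 0.
Proof.
pose f : {additive chains -> chains} := boundary r \o boundary r.
have := @chains_additive_eq _ f \0; apply => s /=.
rewrite boundaryE /boundary_gen.
case: ifP => [/andP[sK rs]|_]; last by rewrite raddf0.
rewrite /face_sum raddf_sum.
have fK i : spans_simplex (face i s).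
  exact: spans_simplex_subseq (face_subseq i s) sK.
have [rs2|rs2] := boolP (r || (2 < size s)%N).
  rewrite -[RHS](face_face_sum s); apply: eq_bigr => i _.
  rewrite raddfMz /= boundaryE /boundary_gen fK size_face //=.
  suff -> : r || (1 < (size s).-1)%N by [].
  by clear f; case: r rs rs2 => //=; lia.
apply: big1 => i _; rewrite raddfMz /= boundaryE /boundary_gen fK size_face //=.
suff /negPf-> : ~~ (r || (1 < (size s).-1)%N) by rewrite mul0rz.
by clear f; case: r rs rs2 => //=; lia.
Qed.

Lemma alternating_sum (W : zmodType) (F : S -> S -> W) :
  (forall x, F x x = 0) -> (forall x y, F x y = - F y x) ->
  \sum_x \sum_y F x y = 0.
Proof.
move=> F0 FN; pose r (x y : S) := (enum_rank x < enum_rank y)%N.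
have E x : \sum_y F x y = \sum_(y | r x y) F x y + \sum_(y | r y x) F x y.
  rewrite (bigID (r x)) /=; congr (_ + _).
  rewrite (bigD1 x) /=; last by rewrite /r ltnn.
  rewrite F0 add0r; apply: eq_bigl => y; rewrite /r -leqNgt ltn_neqAle andbC.
  by rewrite -(inj_eq enum_rank_inj) -val_eqE.
rewrite (eq_bigr _ (fun x _ => E x)) big_split /=.
rewrite [X in _ + X](exchange_big_dep xpredT) //= -big_split big1 //= => x _.
by rewrite -big_split big1 //= => y _; rewrite FN addNr.
Qed.

Lemma coboundaryK a : coboundary (coboundary a) = 0.
Proof.
pose f : {additive chains -> chains} := coboundary \o coboundary.
have := @chains_additive_eq _ f \0; apply => s /=.
rewrite coboundaryE raddf_sum /=.
under eq_bigr do rewrite coboundaryE.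
apply: alternating_sum => [x|x y]; last exact: (osimplex_swap [::]).
by apply: osimplex_null; rewrite /spans_simplex /= inE eqxx.
Qed.

Lemma signK a : sign (sign a) = a.
Proof.
pose f : {additive chains -> chains} := sign \o sign.
have := @chains_additive_eq _ f idfun; apply => s /=.
by rewrite signE raddfMz /= signE -mulrzA -expr2 sqrr_sign.
Qed.

Lemma sign_boundary r a : sign (boundary r a) = - boundary r (sign a).
Proof.
pose f : {additive chains -> chains} := sign \o boundary r.
pose g : {additive chains -> chains} := -%R \o (boundary r \o sign).
have := @chains_additive_eq _ f g; apply => s /=.
rewrite signE raddfMz /= boundaryE /boundary_gen.
case: ifP => _; last by rewrite raddf0 mul0rz oppr0.
rewrite /face_sum raddf_sum mulrz_suml -sumrN; apply: eq_bigr => i _.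
rewrite raddfMz /= signE /sign_gen size_face // -!mulrzA -mulrNz; congr (_ *~ _).
move: (nat_of_ord i) (ltn_ord i) => k; case: (size s) => // n _.
by rewrite /= exprS mulN1r mulrN opprK mulrC.
Qed.

(* Sequences generating C_n(K). The empty one, of dimension -1, is allowed only
   in the reduced case ([r = true]). *)
Definition has_dim (r : bool) (n : int) s : bool :=
  ((size s)%:Z - 1 == n) && (r || (s != [::])).

Definition chain_part (r : bool) (n : int) : zmodClosed chains :=
  span (fun a => exists2 s, has_dim r n s & a = osimplex s).

Lemma chain_part_gen r n s : has_dim r n s -> osimplex s \in chain_part r n.
Proof. by move=> sn; apply: mem_span; exists s. Qed.

Lemma has_dim_face r n s (i : 'I_(size s)) :
  r || (1 < size s)%N -> has_dim r n s -> has_dim r (n - 1) (face i s).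
Proof.
move=> rs /andP[/eqP<- _]; rewrite /has_dim -size_eq0 size_face //.
by case: r rs (ltn_ord i) => /=; move: (nat_of_ord i) => k; lia.
Qed.

Lemma has_dim_cons r n x s : has_dim r n s -> has_dim r (n + 1) (x :: s).
Proof. by move=> /andP[/eqP<- _]; rewrite /has_dim orbT andbT /=; lia. Qed.

Lemma boundary_part r n a :
  a \in chain_part r n -> boundary r a \in chain_part r (n - 1).
Proof.
move: a; apply: span_additive => _ [s sn ->].
rewrite /= boundaryE /boundary_gen; case: ifP => [/andP[_ rs]|_]; last exact: rpred0.
by apply: rpred_sum => i _; apply/rpredMz/chain_part_gen/has_dim_face.
Qed.

Lemma coboundary_part r n a :
  a \in chain_part r n -> coboundary a \in chain_part r (n + 1).
Proof.
move: a; apply: span_additive => _ [s sn ->]; rewrite /= coboundaryE.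
by apply: rpred_sum => x _; apply/chain_part_gen/has_dim_cons.
Qed.

Definition chain_complex (r : bool) : complex (-1) :=
  Complex (@boundary_part r) (boundaryK r).

Definition cochain_complex (r : bool) : complex 1 :=
  Complex (@coboundary_part r) coboundaryK.

Definition chains2 : zmodType := tensor chains chains.

(* N^(p,q)(K). For [r = false] only direct summands C_k(K) of [chains] with
   k >= 0 occur, so that C_p(K) (x) C^q(K) embeds in [chains2]. *)
Definition N_part (r : bool) (p q : int) : zmodClosed chains2 :=
  span (fun a => exists s t, [/\ has_dim r p s, has_dim r q t, {subset s <= t}
                               & a = tens (osimplex s) (osimplex t)]).

Definition N_sum (r : bool) (I : int -> int -> Prop) : zmodClosed chains2 :=
  span (fun a => exists p q, I p q /\ a \in N_part r p q).

Definition N_total (r : bool) : zmodClosed chains2 :=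
  N_sum r (fun _ _ => True).

Definition N (r : bool) : zmodType := subgrp (N_total r).

Definition N_boundary (r : bool) : chains2 -> chains2 :=
  tensor_map (boundary r) idfun.
HB.instance Definition _ r := GRing.isZmodMorphism.Build chains2 chains2
  (N_boundary r) (raddfB (tensor_map (boundary r) idfun)).

Definition N_coboundary : chains2 -> chains2 := tensor_map sign coboundary.
HB.instance Definition _ := GRing.isZmodMorphism.Build chains2 chains2
  N_coboundary (raddfB (tensor_map sign coboundary)).

Lemma N_boundaryE r a b : N_boundary r (tens a b) = tens (boundary r a) b.
Proof. exact: tensor_mapE. Qed.
Lemma N_coboundaryE a b :
  N_coboundary (tens a b) = tens (sign a) (coboundary b).
Proof. exact: tensor_mapE. Qed.

Lemma N_boundary_part r p q a :
  a \in N_part r p q -> N_boundary r a \in N_part r (p - 1) q.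
Proof.
move: a; apply: span_additive => _ [s [t [sp tq st ->]]].
rewrite /= N_boundaryE boundaryE /boundary_gen /=.
case: ifP => [/andP[_ rs]|_]; last first.
  by rewrite -(subrr (0 : chains)) tens_is_zmod_morphism_l subrr rpred0.
rewrite -[tens _ _]/(tensl _ _) raddf_sum; apply: rpred_sum => i _.
rewrite raddfMz; apply/rpredMz/mem_span; exists (face i s), t; split => //.
  exact: has_dim_face.
by move=> x /(mem_subseq (face_subseq i s)) /st.
Qed.

Lemma N_coboundary_part r p q a :
  a \in N_part r p q -> N_coboundary a \in N_part r p (q + 1).
Proof.
move: a; apply: span_additive => _ [s [t [sp tq st ->]]].
rewrite /= N_coboundaryE signE coboundaryE.
rewrite -[tens _ _]/(tensl _ _) raddfMz; apply: rpredMz.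
rewrite /= /tensl raddf_sum; apply: rpred_sum => x _; apply: mem_span.
exists s, (x :: t); split=> //; first exact: has_dim_cons.
by move=> y /st yt; rewrite inE yt orbT.
Qed.

Lemma N_boundary_total r a : a \in N_total r -> N_boundary r a \in N_total r.
Proof.
move: a; apply: span_additive => a [p [q [_ /N_boundary_part aN]]].
by apply: mem_span; exists (p - 1), q.
Qed.

Lemma N_coboundary_total r a : a \in N_total r -> N_coboundary a \in N_total r.
Proof.
move: a; apply: span_additive => a [p [q [_ /N_coboundary_part aN]]].
by apply: mem_span; exists p, (q + 1).
Qed.

Definition N_bd (r : bool) : N r -> N r := restr (@N_boundary_total r).
HB.instance Definition _ r := GRing.isZmodMorphism.Build (N r) (N r) (@N_bd r)
  (raddfB (restr (@N_boundary_total r))).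

Definition N_cobd (r : bool) : N r -> N r := restr (@N_coboundary_total r).
HB.instance Definition _ r := GRing.isZmodMorphism.Build (N r) (N r) (@N_cobd r)
  (raddfB (restr (@N_coboundary_total r))).

Definition Delta (r : bool) (x : N r) : N r := N_bd x + N_cobd x.

Lemma Delta_is_zmod_morphism r : zmod_morphism (@Delta r).
Proof. by move=> x y; rewrite /Delta !raddfB addrACA opprD. Qed.
HB.instance Definition _ r := GRing.isZmodMorphism.Build (N r) (N r) (@Delta r)
  (@Delta_is_zmod_morphism r).

Lemma DeltaK r (z : N r) : Delta (Delta z) = 0.
Proof.
apply: val_inj; rewrite /Delta /N_bd /N_cobd /restr /= !raddfD /=.
move: (val z) => a.
pose f : {additive chains2 -> chains2} := N_boundary r \o N_boundary r.
pose g : {additive chains2 -> chains2} := N_coboundary \o N_coboundary.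
pose h : {additive chains2 -> chains2} := N_boundary r \o N_coboundary.
pose h' : {additive chains2 -> chains2} := -%R \o (N_coboundary \o N_boundary r).
have f0 : f =1 \0.
  apply: tensor_additive_eq => b c /=.
  by rewrite !N_boundaryE boundaryK -[LHS]/(tensl _ _) raddf0.
have g0 : g =1 \0.
  by apply: tensor_additive_eq => b c /=; rewrite !N_coboundaryE coboundaryK raddf0.
have hh : h =1 h'.
  apply: tensor_additive_eq => b c /=.
  rewrite N_boundaryE !N_coboundaryE N_boundaryE sign_boundary.
  by rewrite -[in RHS]/(tensl _ _) raddfN opprK.
move: (f0 a) (g0 a) (hh a) => /= -> -> ->.
by rewrite add0r addr0 addNr.
Qed.

Definition T_part (r : bool) (n : int) : zmodClosed (N r) :=
  preim_add val (N_sum r (fun p q => q - p = n)).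

Lemma Delta_part r n (x : N r) : x \in T_part r n -> Delta x \in T_part r (n + 1).
Proof.
move=> xT.
suff: N_boundary r (val x) + N_coboundary (val x)
    \in N_sum r (fun p q => q - p = n + 1) by [].
have {xT} : val x \in N_sum r (fun p q => q - p = n) by [].
move: (val x) => {x} a aT; apply: rpredD; move: a aT; apply: span_additive.
  move=> a [p [q [<- /N_boundary_part aN]]].
  by apply: mem_span; exists (p - 1), q; split=> //; lia.
move=> a [p [q [<- /N_coboundary_part aN]]].
by apply: mem_span; exists p, (q + 1); split=> //; lia.
Qed.

Definition T_cochain (r : bool) : complex 1 :=
  Complex (@Delta_part r) (@DeltaK r).

Definition N_dual (r : bool) : zmodType := Hom (N r) int.

(* Hom(N^(p,q)(K), Z), extended by zero to the other bidegrees. As only finitely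
   many N^(p,q)(K) are nonzero, Hom(N, Z) is the direct sum of these groups. *)
Definition N_dual_pred (r : bool) (p q : int) : {pred N_dual r} :=
  fun phi => `[< forall p' q' (x : N r), (p', q') <> (p, q) ->
    val x \in N_part r p' q' -> app phi x = 0 >].

Lemma N_dual_zmod_closed r p q : zmod_closed (@N_dual_pred r p q).
Proof.
split=> [|f g /asboolP fN /asboolP gN]; apply/asboolP => // p' q' x pq xN.
change (app f x - app g x = 0).
by rewrite (fN p' q') ?(gN p' q') ?subrr.
Qed.
HB.instance Definition _ r p q := GRing.isZmodClosed.Build (N_dual r)
  (@N_dual_pred r p q) (@N_dual_zmod_closed r p q).

Definition N_dual_part (r : bool) (p q : int) : zmodClosed (N_dual r) :=
  @N_dual_pred r p q.

Definition T_dual_part (r : bool) (n : int) : zmodClosed (N_dual r) :=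
  span (fun phi => exists p q, q - p = n /\ phi \in N_dual_part r p q).

Definition Delta_dual (r : bool) : {additive N_dual r -> N_dual r} :=
  precomp int (@Delta r).

Lemma Delta_dual_part r n phi : phi \in T_dual_part r n -> Delta_dual r phi \in T_dual_part r (n - 1).
Proof.
move: phi; apply: span_additive => phi [p [q [<- /asboolP phiN]]].
have -> : Delta_dual r phi = precomp int (@N_bd r) phi + precomp int (@N_cobd r) phi.
  by apply: homP => x; apply: (raddfD (app phi)).
apply: rpredD; apply: mem_span.
  exists (p + 1), q; split; first lia.
  apply/asboolP => p' q' x pq /N_boundary_part xN.
  by apply: (phiN (p' - 1) q') => // -[pp qq]; apply: pq; congr (_, _); lia.
exists p, (q - 1); split; first lia.
apply/asboolP => p' q' x pq /N_coboundary_part xN.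
by apply: (phiN p' (q' + 1)) => // -[pp qq]; apply: pq; congr (_, _); lia.
Qed.

Lemma Delta_dualK r phi : Delta_dual r (Delta_dual r phi) = 0.
Proof.
by apply: homP => x; transitivity (app phi (Delta (Delta x)));
  rewrite // DeltaK raddf0.
Qed.

Definition T_chain (r : bool) : complex (-1) := Complex (@Delta_dual_part r) (@Delta_dualK r).

End Chains.

(* Main.v *)
Require Import Defs.
From HB Require Import structures.
From mathcomp Require Import all_boot all_order all_algebra.
From mathcomp Require Import boolp zify ring.

Set Implicit Arguments.
Unset Strict Implicit.
Unset Printing Implicit Defensive.

Import Order.TTheory GRing.Theory Num.Theory.

Local Open Scope ring_scope.

(** The double complex N(K) is studied column by column, the column of a simplex [t]
    being spanned by the [s (x) t] with [s] a face of [t] and having the boundary of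
    [s] as differential. It is the chain complex of the full simplex [t], which is a
    cone. In the unreduced case its homology is therefore Z, concentrated on the
    vertices, and what is left when all columns are replaced by their homology is
    the cochain complex of K. In the reduced case the column of [t] is acyclic unless
    [t] is empty, and what is left is a single copy of Z in total degree 0.

    Instead of a spectral sequence, the proof uses explicit homotopies. Coning at
    a vertex of [t] that depends on [t] only defines a contraction [h] of all columns
    at once ([contract_boundary_true], [contract_boundary_false]). With respect to
    the total differential, the deformation [1 - Delta h - h Delta], which is
    homotopic to the identity, is the projection on what is left minus a perturbation
    that increases the dimension of [t]. As these dimensions are bounded, a high power
    of the deformation factors through what is left ([iter_deform_factor]). This gives
    a homotopy equivalence of total complexes ([deformation_iso]) whose
    maps and homotopies are additive and homogeneous.

    Such an equivalence can be transposed, which gives the statements on the dual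
    complexes once the dual of the cochain complex of K is known to be its chain
    complex. For that, chains are paired with cochains so that the simplices of K, each
    with an orientation, are orthonormal; they form a basis ([pairing_expand_l],
    [pairing_expand_r]), and the boundary is adjoint to the coboundary
    ([pairing_boundary_true], [pairing_boundary_false]). *)

(** * Isomorphisms on homology from deformations *)

Lemma zmod_iso_bij (V W : zmodType) (f : {additive V -> W}) :
  (forall x, f x = 0 -> x = 0) -> (forall y, exists x, f x = y) -> zmod_iso V W.
Proof.
move=> f_inj f_onto; have ex y : exists x, f x == y.
  by have [x <-] := f_onto y; exists x.
exists f, (fun y => xchoose (ex y)) => [x|y]; last exact/eqP/(xchooseP (ex y)).
apply/eqP; rewrite -subr_eq0; apply/eqP/f_inj.
by rewrite raddfB (eqP (xchooseP (ex (f x)))) subrr.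
Qed.

Lemma zmod_iso_trans (V W U : zmodType) :
  zmod_iso V W -> zmod_iso W U -> zmod_iso V U.
Proof. by move=> [f f_bij] [g g_bij]; exists (g \o f); apply: bij_comp. Qed.

Lemma zmod_iso_trivial (V W : zmodType) :
  zmod_iso V W -> (forall y : W, y = 0) -> forall x : V, x = 0.
Proof.
by move=> [f /bij_inj f_inj] W0 x; apply: f_inj; rewrite (W0 (f x)) raddf0.
Qed.

Section DsumConcentrated.
Variables (I : eqType) (A : I -> zmodType) (i0 : I).
Hypothesis A0 : forall i, i != i0 -> forall a : A i, a = 0.

Definition dsum_at (f : dsum A) : A i0 := val f i0.
Lemma dsum_at_is_zmod_morphism : zmod_morphism dsum_at.
Proof. by []. Qed.
HB.instance Definition _ :=
  GRing.isZmodMorphism.Build (dsum A) (A i0) dsum_at dsum_at_is_zmod_morphism.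

Lemma dsum_concentrated : zmod_iso (dsum A) (A i0).
Proof.
apply: (@zmod_iso_bij _ _ dsum_at) => [f f0|a].
  apply/val_inj/functional_extensionality_dep => i.
  by have [->|ii0] := eqVneq i i0; [exact: f0|exact: A0].
(* The summands have different types, so the element of A i0 has to be carried
   along an equality of indices to be placed in position i0. *)
pose g : dprod A := fun i =>
  if i =P i0 is ReflectT ii0 then ecast k (A k) (esym ii0) a else 0.
have gE : g i0 = a.
  by rewrite /g; case: eqP => // ii0; rewrite (eq_axiomK ii0).
have g_fin : g \in @finsupp I A.
  apply/asboolP; exists [:: i0] => i; rewrite inE => ii0; exact: A0.
by exists (exist _ g g_fin).
Qed.
End DsumConcentrated.

(** An additive map induces an isomorphism on homology as soon as it preserves
    cycles, preserves and reflects boundaries among cycles, and is onto cycles. *)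
Section HomologyIso.
Variables (e : int) (X Y : complex e) (f : {additive cgrp X -> cgrp Y}) (n : int).
Hypothesis f_cycle : forall z, z \in is_cycle X n -> f z \in is_cycle Y n.
Hypothesis f_boundary : forall z, z \in is_cycle X n ->
  (exists2 y, y \in cpart Y (n - e) & f z = cdiff Y y) <->
  (exists2 x, x \in cpart X (n - e) & z = cdiff X x).
Hypothesis f_onto :
  forall w, w \in is_cycle Y n -> exists2 z, z \in is_cycle X n & f z = w.

Definition cycle_class (z : cycles X n) : homology Y n :=
  proj (is_boundary Y n) (exist _ (f (val z)) (f_cycle (valP z)) : cycles Y n).

Lemma cycle_class_is_zmod_morphism : zmod_morphism cycle_class.
Proof.
move=> z z'; rewrite /cycle_class -raddfB; congr (proj _ _).
by apply: val_inj; rewrite /= raddfB.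
Qed.
HB.instance Definition _ := GRing.isZmodMorphism.Build (cycles X n)
  (homology Y n) cycle_class cycle_class_is_zmod_morphism.

Lemma cycle_class_eq0 z : cycle_class z = 0 <-> z \in is_boundary X n.
Proof.
have zX : val z \in is_cycle X n := valP z.
rewrite /cycle_class; split.
  by move=> /proj_eq0/asboolP/(f_boundary zX) bd; apply/asboolP.
by move=> /asboolP/(f_boundary zX) bd; apply/proj_eq0/asboolP.
Qed.

Lemma homology_iso : zmod_iso (homology X n) (homology Y n).
Proof.
have H0 z : z \in is_boundary X n -> cycle_class z = 0.
  by move=> zb; apply/cycle_class_eq0.
apply: (@zmod_iso_bij _ _ (quot_lift H0)) => [a|b].
  have := quot_liftE H0 (repr a); rewrite proj_repr => aE a0.
  have /cycle_class_eq0 zb := etrans (esym aE) a0.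
  by rewrite -(proj_repr a); apply/proj_eq0.
have [z zX fz] := f_onto (valP (repr b)).
exists (proj (is_boundary X n) (exist _ z zX : cycles X n)).
apply: etrans (quot_liftE H0 _) _; rewrite -[RHS]proj_repr; congr (proj _ _).
exact: val_inj.
Qed.
End HomologyIso.

Section Deform.
Variables (V : zmodType) (d h : {additive V -> V}).

(** If [d] is a differential, this is a map of complexes that is homotopic to the
    identity, with [h] as the homotopy. *)
Definition deform (x : V) : V := x - d (h x) - h (d x).

Lemma deform_is_zmod_morphism : zmod_morphism deform.
Proof. exact: (raddfB (idfun \- (d \o h) \- (h \o d))). Qed.
HB.instance Definition _ :=
  GRing.isZmodMorphism.Build V V deform deform_is_zmod_morphism.
End Deform.

Section IterAdditive.
Variables (V : zmodType) (f : {additive V -> V}) (m : nat).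
Definition iter_add (x : V) : V := iter m f x.
Lemma iter_add_is_zmod_morphism : zmod_morphism iter_add.
Proof. by rewrite /iter_add => x y; elim: m => //= k ->; rewrite raddfB. Qed.
HB.instance Definition _ :=
  GRing.isZmodMorphism.Build V V iter_add iter_add_is_zmod_morphism.
End IterAdditive.

(** The perturbation argument. Suppose that the deformation [1 - d h - h d] is
    [j p - eta], where [j p] is a projector that [eta] maps into its kernel and
    [eta] raises the filtration [F]. On the kernel of [p] the deformation is
    [- eta], so that its powers push that kernel to ever higher filtration and
    eventually kill it; a high power of the deformation therefore depends on its
    argument [x] only through [p x]. *)
Section Perturbation.
Variables (V W : zmodType) (d h eta : {additive V -> V}).
Variables (p : {additive V -> W}) (j : {additive W -> V}).
Variables (F : nat -> V -> Prop) (m : nat).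
Hypothesis deformE : forall x, deform d h x = j (p x) - eta x.
Hypothesis p_eta : forall x, p (eta x) = 0.
Hypothesis pjp : forall x, p (j (p x)) = p x.
Hypothesis F0 : forall x, F 0 x.
Hypothesis FS : forall k x, F k x -> F k.+1 (eta x).
Hypothesis FN : forall k x, F k x -> F k (- x).
Hypothesis Fm : forall x, F m x -> x = 0.

Lemma p_deform x : p (deform d h x) = p x.
Proof. by rewrite deformE raddfB pjp p_eta subr0. Qed.

Lemma p_iter_deform k x : p (iter_add (deform d h) k x) = p x.
Proof. by elim: k => // k <-; apply: p_deform. Qed.

Lemma iter_deform_ker x : p x = 0 -> iter_add (deform d h) m x = 0.
Proof.
move=> px; apply: Fm; elim: m => [|k IH]; first exact: F0.
rewrite -[iter_add _ _ _]/(deform d h (iter_add (deform d h) k x)).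
rewrite deformE p_iter_deform px.
by rewrite raddf0 sub0r; apply/FN/FS.
Qed.

Lemma iter_deform_factor x :
  iter_add (deform d h) m x = iter_add (deform d h) m (j (p x)).
Proof.
apply/eqP; rewrite -subr_eq0 -raddfB; apply/eqP/iter_deform_ker.
by rewrite raddfB pjp subrr.
Qed.
End Perturbation.

(** Let [f] and [g] be maps of complexes such that [f g] is the identity and
    [g f] is a power of a deformation of [X], which is homotopic to the identity.
    Then [f] and [g] are inverse to each other on homology. The identities for
    [f g] are only required on homogeneous elements because the group of a
    complex may be larger than the sum of its homogeneous parts. The maps commute
    with the differentials up to the sign -1, which is the sign that the
    differential [Delta] produces and is invisible to homology. *)
Section DeformationEquivalence.
Variables (e : int) (X Y : complex e).
Variables (f : {additive cgrp X -> cgrp Y}) (g : {additive cgrp Y -> cgrp X}).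
Variables (h : {additive cgrp X -> cgrp X}) (m : nat).
Hypothesis f_part : forall n x, x \in cpart X n -> f x \in cpart Y n.
Hypothesis g_part : forall n y, y \in cpart Y n -> g y \in cpart X n.
Hypothesis h_part : forall n x, x \in cpart X n -> h x \in cpart X (n - e).
Hypothesis fg : forall n y, y \in cpart Y n -> f (g y) = y.
Hypothesis gf : forall x, g (f x) = iter_add (deform (cdiff X) h) m x.

Lemma deform_comm k x : iter_add (deform (cdiff X) h) k (cdiff X x) =
  cdiff X (iter_add (deform (cdiff X) h) k x).
Proof.
rewrite /iter_add; elim: k => //= k ->; move: (iter k _ x) => y.
by rewrite /deform cdiffK raddf0 subr0 !raddfB /= cdiffK subr0.
Qed.

Lemma deform_homotopic k n z : z \in is_cycle X n ->
  iter_add (deform (cdiff X) h) k z \in is_cycle X n /\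
  exists2 y, y \in cpart X (n - e)
           & z - iter_add (deform (cdiff X) h) k z = cdiff X y.
Proof.
move=> zX; rewrite /iter_add; elim: k => [|k [/andP[xn /eqP dx] [y yn yE]]] /=.
  by split=> //; exists 0; rewrite ?rpred0 // subrr raddf0.
move: (iter k _ z) xn dx yE => x xn dx yE; have hx := h_part xn.
rewrite /deform dx raddf0 subr0; split.
  apply/andP; split; last by rewrite raddfB /= dx cdiffK subrr.
  by apply: rpredB => //; have := cdiff_part hx; rewrite subrK.
exists (y + h x); first exact: rpredD.
by rewrite (raddfD (cdiff X)) -yE opprD opprK addrA.
Qed.

Lemma deform_part k n x : x \in cpart X n ->
  iter_add (deform (cdiff X) h) k x \in cpart X n.
Proof.
move=> xn; rewrite /iter_add; elim: k => //= k; move: (iter k _ x) => y yn.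
rewrite /deform; apply: rpredB; first apply: rpredB => //.
  by have := cdiff_part (h_part yn); rewrite subrK.
by have := h_part (cdiff_part yn); rewrite addrK.
Qed.

Definition anticommuting (A B : complex e) (u : cgrp A -> cgrp B) :=
  forall n x, x \in cpart A n -> u (cdiff A x) = - cdiff B (u x).

(** Every homogeneous [y] is [f (g y)], and [g f] commutes with the differential;
    so compatibility of [f] with the differentials passes to [g]. *)
Lemma anticommuting_homotopy_inverse : anticommuting f -> anticommuting g.
Proof.
move=> fd n y yn; rewrite -[in LHS](fg yn).
rewrite -[cdiff Y (f (g y))]opprK -(fd n) ?g_part // raddfN gf deform_comm.
by rewrite -gf (fg yn).
Qed.

(** The mirror image: here [g], being injective on homogeneous elements, passes
    its compatibility on to [f]. *)
Lemma anticommuting_homotopy_retraction : anticommuting g -> anticommuting f.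
Proof.
move=> gd n x xn; have fx := f_part xn.
rewrite -[in LHS](fg (f_part (cdiff_part xn))) gf deform_comm -gf.
by rewrite -[cdiff X _]opprK -(gd n) // raddfN (fg (cdiff_part fx)).
Qed.

Lemma deformation_iso n : anticommuting f -> anticommuting g ->
  zmod_iso (homology X n) (homology Y n).
Proof.
move=> fd gd.
have f_cycle z : z \in is_cycle X n -> f z \in is_cycle Y n.
  move=> /andP[zn /eqP dz]; apply/andP; split; first exact: f_part.
  by rewrite -[cdiff Y _]opprK -(fd n) // dz raddf0 oppr0.
apply: (homology_iso (f := f) f_cycle) => [z zX|w /andP[wn /eqP dw]]; last first.
  exists (g w); last exact: fg wn.
  apply/andP; split; first exact: g_part.
  by rewrite -[cdiff X _]opprK -(gd n) // dw raddf0 oppr0.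
split=> [[y yn fz]|[x xn ->]]; last first.
  by exists (- f x); rewrite ?rpredN ?f_part // raddfN; apply: fd xn.
have [_ [x xn /eqP]] := deform_homotopic m zX.
rewrite -gf fz (_ : g _ = cdiff X (- g y)); last by rewrite raddfN; apply: gd yn.
rewrite subr_eq -raddfD => /eqP->.
by exists (x + - g y) => //; rewrite rpredB ?g_part.
Qed.
End DeformationEquivalence.

(** * Contraction of the columns *)

Section Contraction.
Variables (S : finType) (K : simplicial_complex S).
Implicit Types (s t u v : seq S) (x y : S).

Lemma tens0l (A B : zmodType) (b : B) : tens (0 : A) b = 0.
Proof. exact: (raddf0 (tensl b)). Qed.

(** Non-simplices give zero, so that only pairs consisting of a simplex and a
    face of it have to be considered; the guard [r || (s != [::])] is what
    distinguishes the two versions of N(K), the second factor being at least as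
    long as the first. *)
Lemma N_total_ind r (H : zmodClosed (chains2 K)) :
  (forall s t, [&& r || (s != [::]), uniq s & spans_simplex K t] ->
     {subset s <= t} -> tens (osimplex K s) (osimplex K t) \in H) ->
  forall a, a \in N_total K r -> a \in H.
Proof.
move=> Hst; apply: span_sub => a [p [q [_]]]; move: a.
apply: span_sub => _ [s [t [/andP[_ rs] _ st ->]]].
have [tK|/osimplex_null->] := boolP (spans_simplex K t); last first.
  by rewrite raddf0 rpred0.
have [sU|sN] := boolP (uniq s); first by apply: Hst; rewrite ?rs ?sU.
by rewrite osimplex_null ?tens0l ?rpred0 // /spans_simplex (negPf sN).
Qed.

Lemma N_total_additive_eq r (W : zmodType) (f g : {additive chains2 K -> W}) :
  (forall s t, [&& r || (s != [::]), uniq s & spans_simplex K t] ->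
     {subset s <= t} -> f (tens (osimplex K s) (osimplex K t)) =
                        g (tens (osimplex K s) (osimplex K t))) ->
  forall a, a \in N_total K r -> f a = g a.
Proof.
move=> fg a aN.
pose G b := exists s t, [/\ [&& r || (s != [::]), uniq s & spans_simplex K t],
  {subset s <= t} & b = tens (osimplex K s) (osimplex K t)].
apply: (@span_additive_eq _ G) => [_ [s [t [stK st ->]]]|]; first exact: fg.
by apply: N_total_ind aN => s t stK st; apply: mem_span; exists s, t.
Qed.

Lemma aug_swap (r : bool) u x y v :
  (size (u ++ x :: y :: v) == ~~ r :> nat)%:Z =
  - (size (u ++ y :: x :: v) == ~~ r :> nat)%:Z.
Proof. by rewrite !size_cat /= !addnS; case: r. Qed.

Lemma spans_simplex_nil : spans_simplex K [::].
Proof.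
rewrite /spans_simplex.
suff -> : [set x in [::]] = set0 :> {set S} by exact: simplices_empty.
by apply/setP => x; rewrite !inE.
Qed.

Lemma spans_simplex1 x : spans_simplex K [:: x].
Proof.
rewrite /spans_simplex.
suff -> : [set y in [:: x]] = [set x] by exact: simplices_vertex.
by apply/setP => y; rewrite !inE.
Qed.

Lemma aug_null r s : ~~ spans_simplex K s -> (size s == ~~ r :> nat)%:Z = 0.
Proof.
case: s => [|x [|y s]]; last by case: r.
  by rewrite spans_simplex_nil.
by rewrite spans_simplex1.
Qed.

(** Up to the identification of C_(-1) with Z, [aug false] is the augmentation
    C_0 -> C_(-1) and [aug true] is the identity of C_(-1): the length singled out
    by [r] is that of the generators of lowest degree of the complex named by [r]. *)
Definition aug (r : bool) : chains K -> int := chain_lift (aug_swap r) (@aug_null r).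
HB.instance Definition _ r := GRing.isZmodMorphism.Build (chains K) int (aug r)
  (raddfB (chain_lift (aug_swap r) (@aug_null r))).

Lemma augE r s : aug r (osimplex K s) = (size s == ~~ r :> nat)%:Z.
Proof. exact: chain_liftE. Qed.

Lemma spans_simplex_subset s t :
  uniq s -> {subset s <= t} -> spans_simplex K t -> spans_simplex K s.
Proof.
move=> sU st /andP[_ tK]; rewrite /spans_simplex sU /=.
by apply: simplices_sub tK _; apply/subsetP => x; rewrite !inE => /st.
Qed.

(** If [x] is a vertex of [s], every face of [s] but the one opposite to [x] still
    contains [x] and is killed by the cone; a sequence with repeated entries is
    zero anyway. *)
Lemma cone_face_sum x s : x \in s -> cone x (face_sum K s) = osimplex K s.
Proof.
have cone_null2 y t : y \in t -> cone y (osimplex K t) = 0.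
  by move=> yt; rewrite coneE osimplex_null // /spans_simplex /= yt.
have coneK y (a : chains K) : cone y (cone y a) = 0.
  have := @chains_additive_eq _ _ _ (cone y \o cone y) \0; apply => t /=.
  by rewrite coneE cone_null2 // inE eqxx.
elim: s => // y s IH; rewrite inE face_sum_cons raddfB /=.
case: eqVneq => [->|_] /= xs; first by rewrite coneK coneE subr0.
by rewrite cone_null2 // coneC IH // coneE sub0r opprK.
Qed.

(** A full simplex [t] is a cone over any of its vertices, hence the cone operator
    contracts its reduced complex. When [x] already lies in [s] the cone on [s] is
    degenerate and the identity comes from [cone_face_sum] instead. *)
Lemma boundary_cone x s t :
  uniq s -> spans_simplex K t -> {subset x :: s <= t} ->
  boundary true (cone x (osimplex K s)) + cone x (boundary true (osimplex K s))
  = osimplex K s.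
Proof.
move=> sU tK xst; rewrite coneE !boundaryE /boundary_gen !andbT.
rewrite (spans_simplex_subset sU _ tK); last first.
  by move=> y ys; rewrite xst ?inE ?ys ?orbT.
have [xs|xs] := boolP (x \in s).
  by rewrite /spans_simplex /= xs add0r cone_face_sum.
have -> : spans_simplex K (x :: s).
  by apply: spans_simplex_subset tK => //=; rewrite xs.
by rewrite face_sum_cons subrK.
Qed.

(** The two boundaries differ on vertices only, which lets the unreduced
    contraction be deduced from the reduced one. *)
Lemma boundary_aug (a : chains K) :
  boundary true a = boundary false a + osimplex K [::] *~ aug false a.
Proof.
pose f : {additive chains K -> chains K} :=
  boundary false \+ ( *~%R (osimplex K [::]) \o aug false).
have := @chains_additive_eq _ _ _ (boundary true) f; apply => s /=.
rewrite augE !boundaryE /boundary_gen; have [sK|sK] := boolP (spans_simplex K s).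
  case: s {sK} => [|x [|y s]] /=; rewrite ?mulr0z ?addr0 //.
    by rewrite /face_sum big_ord0.
  by rewrite add0r mulr1z face_sum_cons /face_sum big_ord0 raddf0 subr0.
by have := aug_null false sK => /= ->; rewrite mulr0z addr0.
Qed.

(** Substitute the comparison of both boundaries into the fact that the reduced
    boundary squares to zero, and read off the coefficient of the empty simplex. *)
Lemma aug_boundary (a : chains K) : aug false (boundary false a) = 0.
Proof.
have d2 := boundaryK true a.
rewrite (boundary_aug a) raddfD raddfMz /= (boundary_aug (boundary false a)) in d2.
rewrite boundaryK add0r boundaryE /boundary_gen spans_simplex_nil /= in d2.
rewrite /face_sum big_ord0 mul0rz addr0 in d2.
by have := congr1 (aug true) d2; rewrite raddfMz raddf0 /= augE /= intz.
Qed.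

Lemma aug_coboundary (a : chains K) : aug true (coboundary a) = 0.
Proof.
have := @chains_additive_eq _ _ _ (aug true \o @coboundary S K) \0; apply => s /=.
by rewrite coboundaryE raddf_sum big1 // => x _; rewrite /= augE.
Qed.

Lemma aug_sign (a : chains K) : aug false (sign a) = - aug false a.
Proof.
pose f : {additive chains K -> int} := -%R \o aug false.
have := @chains_additive_eq _ _ _ (aug false \o @sign S K) f; apply => s /=.
by rewrite signE raddfMz /= augE /=; case: eqVneq => [->|_]; rewrite ?mul0rz.
Qed.

Lemma vertex_aug_subproof_l (b : chains K) :
  zmod_morphism (fun a : chains K => b *~ aug false a).
Proof. by move=> a a'; rewrite raddfB mulrzBr. Qed.
Lemma vertex_aug_subproof_r (a : chains K) :
  zmod_morphism (fun b : chains K => b *~ aug false a).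
Proof. by move=> b b'; rewrite mulrzBl. Qed.
(** The augmentation of each column: after restriction to N(K) this is the map
    from the total complex to the cochains of K. *)
Definition vertex_aug : chains2 K -> chains K :=
  tensor_lift vertex_aug_subproof_l vertex_aug_subproof_r.
HB.instance Definition _ := GRing.isZmodMorphism.Build
  (chains2 K) (chains K) vertex_aug
  (raddfB (tensor_lift vertex_aug_subproof_l vertex_aug_subproof_r)).
Lemma vertex_augE a b : vertex_aug (tens a b) = b *~ aug false a.
Proof. exact: tensor_liftE. Qed.

Lemma empty_aug_subproof_l (b : chains K) :
  zmod_morphism (fun a : chains K => aug true a * aug true b).
Proof. by move=> a a'; rewrite raddfB mulrBl. Qed.
Lemma empty_aug_subproof_r (a : chains K) :
  zmod_morphism (fun b : chains K => aug true a * aug true b).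
Proof. by move=> b b'; rewrite raddfB mulrBr. Qed.
(** The coefficient of the tensor square of the empty simplex. *)
Definition empty_aug : chains2 K -> int :=
  tensor_lift empty_aug_subproof_l empty_aug_subproof_r.
HB.instance Definition _ := GRing.isZmodMorphism.Build (chains2 K) int empty_aug
  (raddfB (tensor_lift empty_aug_subproof_l empty_aug_subproof_r)).
Lemma empty_augE a b : empty_aug (tens a b) = aug true a * aug true b.
Proof. exact: tensor_liftE. Qed.

(** The chosen vertex depends on the set of entries of [t] only, which makes the
    contraction compatible with the alternation rule in [t]. *)
Definition apex t : option S := [pick x in t].

Definition cone_at t : {additive chains K -> chains2 K} :=
  if apex t is Some x then tensl (osimplex K t) \o cone x else \0.

Lemma apex_perm s t : perm_eq s t -> apex s = apex t.
Proof. by move=> /perm_mem st; apply: eq_pick => x; rewrite /= st. Qed.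

Lemma cone_at_swap u x y v :
  Defs.hom (cone_at (u ++ x :: y :: v)) = - Defs.hom (cone_at (u ++ y :: x :: v)).
Proof.
apply: homP => a.
rewrite -[RHS]/(- cone_at (u ++ y :: x :: v) a) -[LHS]/(cone_at _ a) /cone_at.
rewrite (apex_perm (perm_swap u x y v)); case: (apex _) => [z|] /=.
  by rewrite /tensl osimplex_swap raddfN.
by rewrite oppr0.
Qed.

Lemma cone_at_null t : ~~ spans_simplex K t -> Defs.hom (cone_at t) = 0.
Proof.
move=> tK; apply: homP => a; rewrite -[LHS]/(cone_at _ a) /cone_at.
by case: (apex t) => [x|] //=; rewrite /tensl osimplex_null // raddf0.
Qed.

(** Through homomorphisms out of the first factor, the family of cones becomes
    additive in the second factor as well, hence an operator on the tensor
    product. *)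
Definition cone_hom : chains K -> Defs.Hom (chains K) (chains2 K) :=
  chain_lift cone_at_swap cone_at_null.
HB.instance Definition _ := GRing.isZmodMorphism.Build (chains K)
  (Defs.Hom (chains K) (chains2 K)) cone_hom
  (raddfB (chain_lift cone_at_swap cone_at_null)).

Lemma contract_subproof_l (b : chains K) :
  zmod_morphism (fun a => app (cone_hom b) a).
Proof. exact: raddfB. Qed.
Lemma contract_subproof_r (a : chains K) :
  zmod_morphism (fun b => app (cone_hom b) a).
Proof. by move=> b b'; rewrite raddfB. Qed.
Definition contract : chains2 K -> chains2 K :=
  tensor_lift contract_subproof_l contract_subproof_r.
HB.instance Definition _ := GRing.isZmodMorphism.Build (chains2 K) (chains2 K)
  contract (raddfB (tensor_lift contract_subproof_l contract_subproof_r)).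

Lemma contractE a t : contract (tens a (osimplex K t)) = cone_at t a.
Proof. by rewrite /contract tensor_liftE /cone_hom chain_liftE. Qed.

Lemma apexP t : if apex t is Some x then x \in t else t == [::].
Proof.
rewrite /apex; case: pickP => [x|t0] //=; case: t t0 => // x t /(_ x).
by rewrite inE eqxx.
Qed.

Lemma contract_simplexP s t : {subset s <= t} ->
  (t = [::] /\ contract (tens (osimplex K s) (osimplex K t)) = 0) \/
  exists x, [/\ x \in t, {subset x :: s <= t} &
    forall a, contract (tens a (osimplex K t)) = tens (cone x a) (osimplex K t)].
Proof.
move=> st; have := apexP t; case tx: (apex t) => [x|]; last first.
  by move/eqP=> t0; left; rewrite contractE /cone_at tx.
move=> xt; right; exists x; split=> // [y|a].
  by rewrite inE => /predU1P[->|/st].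
by rewrite contractE /cone_at tx.
Qed.

(** The column of a nonempty simplex [t] is the reduced complex of a full simplex,
    contracted by coning at its apex; only the column of the empty simplex
    survives. *)
Lemma contract_boundary_true a : a \in N_total K true ->
  N_boundary true (contract a) + contract (N_boundary true a) =
  a - tens (osimplex K [::]) (osimplex K [::]) *~ empty_aug a.
Proof.
pose f : {additive chains2 K -> chains2 K} :=
  (N_boundary true \o contract) \+ (contract \o N_boundary true).
pose g : {additive chains2 K -> chains2 K} :=
  idfun \- ( *~%R (tens (osimplex K [::]) (osimplex K [::])) \o empty_aug).
apply: (N_total_additive_eq (f := f) (g := g)) => s t /= /andP[sU tK] st.
rewrite N_boundaryE empty_augE !augE /=.
have [[t0 _]|[x [xt xst hx]]] := contract_simplexP st.
  have s0 : s = [::].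
    by case: s st {sU} => // y s /(_ y); rewrite t0 inE eqxx => /(_ isT).
  rewrite {}t0 {}s0 !contractE /cone_at; have := apexP [::].
  by case: apex => // _; rewrite mulr1z subrr addr0 raddf0.
rewrite !hx N_boundaryE -[RHS](_ : tens (osimplex K s) (osimplex K t) = _); last first.
  by case: (t) xt => // y t' _; rewrite mulr0 mulr0z subr0.
by rewrite -tensDl (boundary_cone _ tK).
Qed.

Lemma vertex_aug_contract a : a \in N_total K false -> vertex_aug (contract a) = 0.
Proof.
apply: (N_total_additive_eq (f := vertex_aug \o contract) (g := \0)).
move=> s t /= /and3P[s0 _ _] st.
have [[_ ->]|[x [xt xst ->]]] := contract_simplexP st; first by rewrite raddf0.
by rewrite vertex_augE coneE augE; case: s s0 {st xst} => //= *; rewrite mulr0z.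
Qed.

Lemma N_total_sub a : a \in N_total K false -> a \in N_total K true.
Proof.
apply: N_total_ind => s t /and3P[_ sU tK] st.
apply: mem_span; exists ((size s)%:Z - 1), ((size t)%:Z - 1); split=> //.
by apply: mem_span; exists s, t; rewrite /has_dim !eqxx.
Qed.

(** In the unreduced column of [t] the contraction reaches the vertices, where it
    replaces a vertex by the apex. The generator (apex) (x) t is written as the
    contraction of (empty) (x) t. *)
Lemma contract_boundary_false a : a \in N_total K false ->
  N_boundary false (contract a) + contract (N_boundary false a) =
  a - contract (tens (osimplex K [::]) (vertex_aug a)).
Proof.
move=> aN.
have bdE b : N_boundary true b =
    N_boundary false b + tens (osimplex K [::]) (vertex_aug b).
  pose f : {additive chains2 K -> chains2 K} :=
    N_boundary false \+ (tens (osimplex K [::]) \o vertex_aug).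
  apply: (@tensor_additive_eq _ _ _ (N_boundary true) f) => {b} b c /=.
  rewrite !N_boundaryE vertex_augE raddfMz boundary_aug tensDl.
  by congr (_ + _); apply: (raddfMz (tensl c)).
have a0 : empty_aug a = 0.
  move: aN; apply: (N_total_additive_eq (f := empty_aug) (g := \0)).
  move=> s t /= /and3P[s0 _ _] _; rewrite empty_augE !augE.
  by case: s s0 => //= *; rewrite mul0r.
have := contract_boundary_true (N_total_sub aN).
rewrite !bdE vertex_aug_contract // raddf0 addr0 raddfD addrA.
by move=> /(canRL (addrK _)) ->; rewrite a0 mulr0z subr0.
Qed.

Lemma vertex_aug_boundary a : vertex_aug (N_boundary false a) = 0.
Proof.
apply: (@tensor_additive_eq _ _ _ (vertex_aug \o N_boundary false) \0) => b c /=.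
by rewrite N_boundaryE vertex_augE aug_boundary mulr0z.
Qed.

Lemma vertex_aug_coboundary a :
  vertex_aug (N_coboundary a) = - coboundary (vertex_aug a).
Proof.
pose f : {additive chains2 K -> chains K} := -%R \o (@coboundary S K \o vertex_aug).
apply: (@tensor_additive_eq _ _ _ (vertex_aug \o @N_coboundary S K) f) => b c /=.
by rewrite N_coboundaryE !vertex_augE aug_sign raddfMz mulrNz.
Qed.

Lemma empty_aug_boundary a : a \in N_total K true ->
  empty_aug (N_boundary true a) = 0.
Proof.
apply: (N_total_additive_eq (f := empty_aug \o N_boundary true) (g := \0)).
move=> s [|x t] /= _ st; rewrite N_boundaryE empty_augE; last by rewrite !augE mulr0.
have -> : s = [::] by case: s st => // y s /(_ y); rewrite inE eqxx => /(_ isT).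
rewrite boundaryE /boundary_gen spans_simplex_nil /= /face_sum big_ord0.
by rewrite raddf0 mul0r.
Qed.

Lemma empty_aug_coboundary a : empty_aug (N_coboundary a) = 0.
Proof.
apply: (@tensor_additive_eq _ _ _ (empty_aug \o @N_coboundary S K) \0) => b c /=.
by rewrite N_coboundaryE empty_augE aug_coboundary mulr0.
Qed.

Lemma empty_aug_contract a : a \in N_total K true -> empty_aug (contract a) = 0.
Proof.
apply: (N_total_additive_eq (f := empty_aug \o contract) (g := \0)).
move=> s t /= _ st.
have [[_ ->]|[x [xt xst ->]]] := contract_simplexP st; first by rewrite raddf0.
by rewrite empty_augE coneE !augE mul0r.
Qed.

Lemma vertex_aug_section s : s != [::] ->
  vertex_aug (contract (tens (osimplex K [::]) (osimplex K s))) = osimplex K s.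
Proof.
move=> s0; have [|[s0' _]|[x [xs _ ->]]] := @contract_simplexP [::] s; first by [].
  by rewrite s0' in s0.
by rewrite vertex_augE coneE augE mulr1z.
Qed.

Lemma contract_part r p q a :
  a \in N_part K r p q -> contract a \in N_part K r (p + 1) q.
Proof.
move: a; apply: span_additive => _ [s [t [sp tq st ->]]] /=.
have [[_ ->]|[x [xt xst ->]]] := contract_simplexP st; first exact: rpred0.
rewrite coneE; apply: mem_span; exists (x :: s), t; split=> //.
exact: has_dim_cons.
Qed.

Lemma contract_total r a : a \in N_total K r -> contract a \in N_total K r.
Proof.
move: a; apply: span_additive => a [p [q [_ /contract_part aN]]].
by apply: mem_span; exists (p + 1), q.
Qed.

(** The decreasing filtration by the dimension of the second factor. It is finite
    since simplices have at most #|S| vertices. *)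
Definition cofilt (k : nat) : zmodClosed (chains2 K) :=
  Defs.span (fun a => exists b t, (k <= size t)%N /\ a = tens b (osimplex K t)).

Lemma cofilt0 a : a \in cofilt 0.
Proof.
have tens_cofilt b c : tens b c \in cofilt 0.
  apply: (@span_additive _ (fun c => exists t, c = osimplex K t) _ _ (tens b)).
    by move=> _ [t ->]; apply: mem_span; exists b, t.
  by apply: presented_ind => t; apply: mem_span; exists t.
by move: a; apply: (@presented_ind _ _ (cofilt 0)) => -[b c]; apply: tens_cofilt.
Qed.

Lemma cofilt_contract k a : a \in cofilt k -> contract a \in cofilt k.
Proof.
move: a; apply: span_additive => _ [b [t [kt ->]]]; rewrite /= contractE /cone_at.
case: apex => [x|] /=; last exact: rpred0.
by apply: mem_span; exists (cone x b), t.
Qed.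

Lemma cofilt_coboundary k a : a \in cofilt k -> N_coboundary a \in cofilt k.+1.
Proof.
move: a; apply: span_additive => _ [b [t [kt ->]]].
rewrite /= N_coboundaryE coboundaryE raddf_sum; apply: rpred_sum => x _.
by apply: mem_span; exists (sign b), (x :: t).
Qed.

Lemma cofilt_card a : a \in cofilt #|S|.+1 -> a = 0.
Proof.
move: a; apply: (@span_additive_eq _ _ _ idfun \0) => _ [b [t [kt ->]]] /=.
rewrite osimplex_null ?raddf0 //; apply/negP => /andP[/card_uniqP tU _].
by have := max_card (mem t); rewrite tU leqNgt kt.
Qed.

End Contraction.

(** * The simplices as an orthonormal basis of the chains *)

Section Pairing.
Variables (S : finType) (K : simplicial_complex S).
Implicit Types (s t u v : seq S) (x y : S).

Definition below x : pred S := fun y => (enum_rank y < enum_rank x)%N.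

Fixpoint inversions s : nat :=
  if s is x :: s' then count (below x) s' + inversions s' else 0.

(** With inversions counted for the enumeration order of the vertices, this is the
    sign of the permutation sorting [s]. Comparing sequences with the sorted one
    avoids choosing a permutation between two of them. *)
Definition sgn s : int := (-1) ^+ inversions s.

Lemma sgn_sqr s : sgn s * sgn s = 1.
Proof. by rewrite -expr2 sqrr_sign. Qed.

Lemma sgn_swap u x y v : x != y ->
  sgn (u ++ x :: y :: v) = - sgn (u ++ y :: x :: v).
Proof.
move=> xy; rewrite /sgn; elim: u => [|z u IH] /=; last first.
  by rewrite (permP (perm_swap u x y v)) !exprD IH mulrN.
have : below x y = ~~ below y x :> bool.
  rewrite /below -leqNgt ltn_neqAle.
  suff -> : enum_rank y != enum_rank x :> nat by [].
  by rewrite val_eqE (inj_eq enum_rank_inj) eq_sym.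
move=> ->; rewrite !exprD; case: (below y x); rewrite /=; ring.
Qed.

Lemma sgn_cons_perm x s t : perm_eq s t ->
  sgn (x :: s) * sgn (x :: t) = sgn s * sgn t.
Proof.
move=> st; rewrite /sgn /= (permP st) !exprD mulrACA -expr2 sqrr_sign.
by rewrite mul1r.
Qed.

(** Moving an entry to the front passes each of the preceding entries once. *)
Lemma osimplex_move_front u x v :
  osimplex K (u ++ x :: v) = osimplex K (x :: u ++ v) *~ (-1) ^+ size u.
Proof.
elim: u => [|y u IH] /=; first by rewrite mulr1z.
rewrite -[LHS]coneE IH raddfMz /= coneE (osimplex_swap K [::]) exprS mulN1r.
by rewrite mulrNz mulNrz.
Qed.

Lemma osimplex_sgn_move_front u x v : x \notin u ->
  osimplex K (u ++ x :: v) *~ sgn (u ++ x :: v) =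
  osimplex K (x :: u ++ v) *~ sgn (x :: u ++ v).
Proof.
elim/last_ind: u v => [|u y IH] v //.
rewrite mem_rcons inE negb_or => /andP[xy xu]; rewrite !cat_rcons -(IH (y :: v) xu).
by rewrite osimplex_swap sgn_swap 1?eq_sym // mulNrz mulrNz opprK.
Qed.

(** The sign cancels the alternation, so an oriented simplex multiplied by its sign
    depends only on its set of vertices. By induction on [s]: move the head of [s]
    to the front of [t] and apply its cone. *)
Lemma osimplex_perm s t : uniq s -> perm_eq s t ->
  osimplex K s *~ sgn s = osimplex K t *~ sgn t.
Proof.
elim: s t => [|x s IH] t; first by rewrite perm_sym => _ /perm_nilP->.
move=> xsU xst; have := perm_mem xst x; rewrite inE eqxx => /esym xt.
case/splitPr: xt xst => u v xst.
have := xsU; rewrite (perm_uniq xst) => /= uvU.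
have xu : x \notin u.
  by move: uvU; rewrite cat_uniq /= => /and3P[_ /norP[]].
have st : perm_eq s (u ++ v).
  by rewrite -(perm_cons x); apply: perm_trans xst _;
    rewrite perm_catC /= perm_cons perm_catC.
rewrite osimplex_sgn_move_front // -!coneE.
have /IH /(_ st)/(congr1 (cone x)) : uniq s by case/andP: xsU.
rewrite !raddfMz /= !coneE /sgn /= (permP st) !exprD => e.
by rewrite mulrC [X in _ = _ *~ X]mulrC !mulrzA e.
Qed.

(** The pairing for which the oriented simplices, one for each simplex of K, form
    an orthonormal basis. *)
Definition pair_gen s t : int :=
  if perm_eq s t && spans_simplex K t then sgn s * sgn t else 0.

Lemma pair_genC s t : pair_gen s t = pair_gen t s.
Proof.
rewrite /pair_gen perm_sym; case: (boolP (perm_eq t s)) => //= ts.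
by rewrite (spans_simplex_perm K ts) mulrC.
Qed.

Lemma pair_gen_swap s u x y v :
  pair_gen s (u ++ x :: y :: v) = - pair_gen s (u ++ y :: x :: v).
Proof.
have uvp := perm_swap u x y v.
rewrite /pair_gen (permPr uvp) (spans_simplex_perm K uvp).
have [->|xy] := eqVneq x y.
  rewrite /spans_simplex; have -> : uniq (u ++ y :: y :: v) = false.
    by rewrite cat_uniq /= inE eqxx !andbF.
  by rewrite andbF oppr0.
by case: ifP => _; rewrite ?oppr0 // sgn_swap // mulrN.
Qed.

Lemma pair_gen_null s t : ~~ spans_simplex K t -> pair_gen s t = 0.
Proof. by rewrite /pair_gen => /negPf->; rewrite andbF. Qed.

Definition pair_at s : {additive chains K -> int} :=
  chain_lift (pair_gen_swap s) (@pair_gen_null s).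

Lemma pair_at_swap u x y v :
  Defs.hom (pair_at (u ++ x :: y :: v)) = - Defs.hom (pair_at (u ++ y :: x :: v)).
Proof.
apply: homP; apply: (chains_additive_eq (f := app _) (g := app _)) => t.
rewrite -[RHS]/(- pair_at (u ++ y :: x :: v) (osimplex K t)).
rewrite -[LHS]/(pair_at _ _) /= !chain_liftE.
by rewrite ![pair_gen _ t]pair_genC pair_gen_swap.
Qed.

Lemma pair_at_null s : ~~ spans_simplex K s -> Defs.hom (pair_at s) = 0.
Proof.
move=> sK; apply: homP; apply: (chains_additive_eq (f := app _) (g := app _)) => t.
by rewrite -[LHS]/(pair_at _ _) /= !chain_liftE pair_genC pair_gen_null.
Qed.

Definition pairing : chains K -> Defs.Hom (chains K) int :=
  chain_lift pair_at_swap pair_at_null.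
HB.instance Definition _ := GRing.isZmodMorphism.Build (chains K)
  (Defs.Hom (chains K) int) pairing (raddfB (chain_lift pair_at_swap pair_at_null)).

Lemma pairingE s t : app (pairing (osimplex K s)) (osimplex K t) = pair_gen s t.
Proof. by rewrite /pairing chain_liftE -[LHS]/(pair_at s _) /= chain_liftE. Qed.

Lemma pairingC (a b : chains K) : app (pairing a) b = app (pairing b) a.
Proof.
have pairing_l c : zmod_morphism (fun a => app (pairing a) c).
  by move=> a1 a2; rewrite raddfB.
pose f c : {additive chains K -> int} :=
  HB.pack (fun a => app (pairing a) c) (GRing.isZmodMorphism.Build _ _ _ (pairing_l c)).
apply: (chains_additive_eq (f := app (pairing a)) (g := f a)) => t /=.
apply: (chains_additive_eq (f := f (osimplex K t)) (g := app (pairing (osimplex K t)))).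
by move=> s /=; rewrite !pairingE pair_genC.
Qed.

Definition basis (A : {set S}) : chains K := osimplex K (enum A).

Lemma pairing_basis_simplex s :
  \sum_(A in simplices K) basis A *~ app (pairing (osimplex K s)) (basis A)
  = osimplex K s.
Proof.
under eq_bigr do rewrite pairingE.
have [sK|sK] := boolP (spans_simplex K s); last first.
  by rewrite osimplex_null // big1 // => A _; rewrite pair_genC pair_gen_null.
have /andP[sU sA] := sK.
rewrite (bigD1 [set x in s]) //= big1 => [|A /andP[_ As]]; last first.
  rewrite /pair_gen; case: ifP => // /andP[/perm_mem sE _].
  case/eqP: As; apply/setP => x; by rewrite inE sE mem_enum.
have sp : perm_eq s (enum [set x in s]).
  by apply: uniq_perm; rewrite ?enum_uniq // => x; rewrite mem_enum inE.
rewrite addr0 /pair_gen sp -(spans_simplex_perm K sp) sK /=.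
by rewrite mulrC mulrzA -(osimplex_perm sU sp) -mulrzA sgn_sqr mulr1z.
Qed.

(** The group of chains is free on the simplices, and the pairing computes the
    coefficients. *)
Lemma pairing_expand_r (a : chains K) :
  \sum_(A in simplices K) basis A *~ app (pairing (basis A)) a = a.
Proof.
pose T (A : {set S}) : {additive chains K -> chains K} :=
  *~%R (basis A) \o app (pairing (basis A)).
have TB : zmod_morphism (fun b => \sum_(A in simplices K) T A b).
  by move=> b b'; rewrite -sumrB; apply: eq_bigr => A _; apply: raddfB.
pose f : {additive chains K -> chains K} :=
  HB.pack (fun b => \sum_(A in simplices K) T A b)
    (GRing.isZmodMorphism.Build _ _ _ TB).
apply: (chains_additive_eq (f := f) (g := idfun)) => s /=.
rewrite -[RHS]pairing_basis_simplex; apply: eq_bigr => A _.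
by rewrite pairingC.
Qed.

Lemma pairing_expand_l (a : chains K) :
  \sum_(A in simplices K) basis A *~ app (pairing a) (basis A) = a.
Proof.
by rewrite -[RHS]pairing_expand_r; apply: eq_bigr => A _; rewrite pairingC.
Qed.

Lemma pair_gen_cons x s t : spans_simplex K (x :: s) ->
  pair_gen (x :: s) (x :: t) = pair_gen s t.
Proof.
move=> xsK; rewrite /pair_gen perm_cons; case: (boolP (perm_eq s t)) => //= st.
have <- : spans_simplex K (x :: s) = spans_simplex K (x :: t).
  by apply: spans_simplex_perm; rewrite perm_cons.
rewrite xsK -(spans_simplex_perm K st).
by rewrite (spans_simplex_subseq (subseq_cons s x) xsK) sgn_cons_perm.
Qed.

(** Only entries [x] of [s] contribute to the right-hand side; writing [s] as a
    permutation of [x :: face i s] matches the term of [x] with that of the face of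
    [s] opposite to [x]. *)
Lemma pairing_boundary_simplex s t :
  app (pairing (boundary true (osimplex K s))) (osimplex K t) =
  app (pairing (osimplex K s)) (coboundary (osimplex K t)).
Proof.
rewrite boundaryE coboundaryE /boundary_gen andbT; case: ifPn => sK; last first.
  by rewrite (osimplex_null sK) raddf0.
have /andP[sU _] := sK.
rewrite /coboundary_gen [RHS]raddf_sum (bigID (mem s)) /=.
rewrite [X in _ = _ + X]big1; last first.
  move=> x xs; rewrite pairingE /pair_gen; case: ifP => // /andP[/perm_mem/(_ x)].
  by rewrite inE eqxx (negPf xs).
rewrite addr0 -big_uniq //= /face_sum.
case: (s) sU sK => [|x0 s'] sU sK; first by rewrite big_ord0 big_nil raddf0.
move: (x0 :: s') sU sK => {}s' sU sK.
rewrite (big_nth x0) big_mkord.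
rewrite pairingC raddf_sum; apply: eq_bigr => i _; rewrite raddfMz /= pairingE.
set x := nth _ _ _.
have sE : s' = take i s' ++ x :: drop i.+1 s'.
  by rewrite -drop_nth // cat_take_drop.
have xfK : spans_simplex K (x :: face i s').
  rewrite -(spans_simplex_perm K (s := s')) // {1}sE perm_catC /= perm_cons.
  by rewrite perm_catC.
have -> : osimplex K s' = osimplex K (x :: face i s') *~ (-1) ^+ i.
  by rewrite {1}sE osimplex_move_front size_takel // ltnW.
by rewrite [RHS]pairingC raddfMz /= pairingE pair_genC [in RHS]pair_genC pair_gen_cons.
Qed.

Lemma pairing_boundary_true (a b : chains K) :
  app (pairing (boundary true a)) b = app (pairing a) (coboundary b).
Proof.
pose f : {additive chains K -> int} := app (pairing (boundary true a)).
pose g : {additive chains K -> int} := app (pairing a) \o @coboundary S K.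
apply: (chains_additive_eq (f := f) (g := g)) => t /=; rewrite pairingC [RHS]pairingC.
pose f' : {additive chains K -> int} := app (pairing (osimplex K t)) \o boundary true.
pose g' : {additive chains K -> int} := app (pairing (coboundary (osimplex K t))).
apply: (chains_additive_eq (f := f') (g := g')) => s /=.
by rewrite pairingC [RHS]pairingC pairing_boundary_simplex.
Qed.

(** The empty simplex has to be excluded: its coboundary is nonzero, while the
    unreduced boundary never reaches it. *)
Lemma pairing_boundary_false (a : chains K) t : t != [::] ->
  app (pairing (boundary false a)) (osimplex K t) =
  app (pairing a) (coboundary (osimplex K t)).
Proof.
move=> t0; rewrite -pairing_boundary_true boundary_aug pairingC [RHS]pairingC.
rewrite raddfD raddfMz /= (pairingE t) /pair_gen.
by case: perm_nilP t0 => [->|_ _] //=; rewrite mul0rz addr0.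
Qed.

End Pairing.

(** * The deformation of the total complex and the unreduced case *)

Section Equivalence.
Variables (S : finType) (K : simplicial_complex S).
Implicit Types (s t : seq S).

Definition N_contract r : N K r -> N K r := restr (@contract_total S K r).
HB.instance Definition _ r := GRing.isZmodMorphism.Build (N K r) (N K r)
  (@N_contract r) (raddfB (restr (@contract_total S K r))).

Definition N_eta r : {additive N K r -> N K r} :=
  (@N_contract r \o @N_cobd S K r) \+ (@N_cobd S K r \o @N_contract r).

Notation deformation r :=
  (iter_add (deform (@Delta S K r) (@N_contract r)) #|S|.+1).

(** The perturbation argument on N(K), common to both versions: [p] and [j] are the
    retraction on what the contraction leaves of the columns, and the perturbation
    [N_eta] raises the dimension of the second factor. *)
Section Retraction.
Variables (r : bool) (W : zmodType).
Variables (p : {additive N K r -> W}) (j : {additive W -> N K r}).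
Hypothesis p_contract : forall x, p (N_contract x) = 0.
Hypothesis p_contract_cobd : forall x, p (N_cobd (N_contract x)) = 0.
Hypothesis contract_bd : forall x,
  N_bd (N_contract x) + N_contract (N_bd x) = x - j (p x).
Hypothesis pjp : forall x, p (j (p x)) = p x.

Let deformE x : deform (@Delta S K r) (@N_contract r) x = j (p x) - N_eta r x.
Proof.
have -> : j (p x) = x - (N_bd (N_contract x) + N_contract (N_bd x)).
  by rewrite contract_bd subKr.
rewrite /deform /= -[LHS]addrA -[RHS]addrA -!opprD; congr (x - _).
rewrite (raddfD (@N_contract r)) /= addrACA; congr (_ + _); exact: addrC.
Qed.

Let p_eta x : p (N_eta r x) = 0.
Proof. by rewrite /N_eta raddfD p_contract p_contract_cobd addr0. Qed.

Lemma p_deformation x : p (deformation r x) = p x.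
Proof. exact: (p_iter_deform deformE p_eta pjp). Qed.

Lemma deformation_factor x : deformation r x = deformation r (j (p x)).
Proof.
apply: (iter_deform_factor (F := fun k x => val x \in cofilt K k) deformE p_eta pjp).
- by move=> y; apply: cofilt0.
- move=> k y yk; apply: rpredD.
    have := cofilt_contract (cofilt_coboundary yk); by [].
  exact: (cofilt_coboundary (cofilt_contract yk)).
- by move=> k y yk; rewrite raddfN rpredN.
- by move=> y /cofilt_card y0; apply: val_inj.
Qed.
End Retraction.

Section Unreduced.

Definition vertex_proj : {additive N K false -> chains K} := @vertex_aug S K \o val.

Lemma vertex_section_subproof b :
  contract (tens (osimplex K [::]) b) \in N_total K false.
Proof.
pose f : {additive chains K -> chains2 K} :=
  @contract S K \o tens (osimplex K [::]).
have : b \in Defs.span (fun b => exists s, b = osimplex K s).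
  by apply: presented_ind => s; apply: mem_span; exists s.
move: b; apply: (span_additive (f := f)) => _ [s ->] /=.
have [|[_ ->]|[x [xs _ ->]]] // := @contract_simplexP _ K [::] s.
  exact: rpred0.
rewrite coneE; apply: mem_span; exists 0, ((size s)%:Z - 1); split=> //.
apply: mem_span; exists [:: x], s; split=> //; last by move=> y; rewrite inE => /eqP->.
by rewrite /has_dim eqxx; case: (s) xs.
Qed.

(** Sends [t] to (apex of t) (x) t; in general this is not a map of complexes,
    since the apex of a simplex need not be that of its cofaces. *)
Definition vertex_section b : N K false :=
  exist _ (contract (tens (osimplex K [::]) b)) (vertex_section_subproof b).
Lemma vertex_section_is_zmod_morphism : zmod_morphism vertex_section.
Proof. by move=> b c; apply: val_inj; rewrite /= !raddfB. Qed.
HB.instance Definition _ := GRing.isZmodMorphism.Build (chains K) (N K false)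
  vertex_section vertex_section_is_zmod_morphism.

Lemma vertex_proj_contract x : vertex_proj (N_contract x) = 0.
Proof. exact: vertex_aug_contract (valP x). Qed.

Lemma vertex_proj_cobd x : vertex_proj (N_cobd x) = - coboundary (vertex_proj x).
Proof. exact: vertex_aug_coboundary. Qed.

Lemma vertex_proj_contract_cobd x : vertex_proj (N_cobd (N_contract x)) = 0.
Proof. by rewrite vertex_proj_cobd vertex_proj_contract raddf0 oppr0. Qed.

Lemma vertex_contract_bd (x : N K false) :
  N_bd (N_contract x) + N_contract (N_bd x) = x - vertex_section (vertex_proj x).
Proof. by apply: val_inj; apply: contract_boundary_false (valP x). Qed.

Lemma vertex_proj_Delta x : vertex_proj (Delta x) = - coboundary (vertex_proj x).
Proof.
rewrite -vertex_proj_cobd /Delta raddfD /=.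
by rewrite [X in X + _]vertex_aug_boundary add0r.
Qed.

(** A pair of nonempty simplices has a nonempty second factor, so the image in the
    chains never involves the empty simplex. *)
Lemma vertex_proj_additive_eq (W : zmodType) (f g : {additive chains K -> W}) :
  (forall s, s != [::] -> f (osimplex K s) = g (osimplex K s)) ->
  forall x, f (vertex_proj x) = g (vertex_proj x).
Proof.
move=> fg x; apply: (N_total_additive_eq
  (f := f \o @vertex_aug S K) (g := g \o @vertex_aug S K) _ (valP x)).
move=> s t /and3P[s0 _ _] st; rewrite /= vertex_augE !raddfMz fg //.
by case: s t s0 st => // x0 s [|//] _ /(_ x0); rewrite inE eqxx => /(_ isT).
Qed.

Lemma vertex_section_nil : vertex_section (osimplex K [::]) = 0.
Proof.
apply: val_inj => /=; rewrite contractE /cone_at.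
by have := apexP (S := S) [::]; case: apex.
Qed.

Lemma vertex_projK n b : b \in chain_part K false n ->
  vertex_proj (vertex_section b) = b.
Proof.
pose f : {additive chains K -> chains K} := vertex_proj \o vertex_section.
move: b; apply: (span_additive_eq (f := f) (g := idfun)) => _ [s /andP[_ s0] ->].
exact: vertex_aug_section.
Qed.

Lemma vertex_projK_image x : vertex_proj (vertex_section (vertex_proj x)) = vertex_proj x.
Proof.
pose f : {additive chains K -> chains K} := vertex_proj \o vertex_section.
apply: (vertex_proj_additive_eq (f := f) (g := idfun)) => s s0.
exact: vertex_aug_section.
Qed.

Lemma vertex_proj_deformation x : vertex_proj (deformation false x) = vertex_proj x.
Proof.
exact: (p_deformation vertex_proj_contract vertex_proj_contract_cobd
  vertex_contract_bd vertex_projK_image).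
Qed.

Lemma vertex_deformation_factor x :
  deformation false x = deformation false (vertex_section (vertex_proj x)).
Proof.
exact: (deformation_factor vertex_proj_contract vertex_proj_contract_cobd
  vertex_contract_bd vertex_projK_image).
Qed.
End Unreduced.

Lemma N_contract_part r n (x : N K r) :
  x \in T_part K r n -> N_contract x \in T_part K r (n - 1).
Proof.
move=> xT.
suff: contract (val x) \in N_sum K r (fun p q => q - p = n - 1) by [].
have {xT} : val x \in N_sum K r (fun p q => q - p = n) by [].
move: (val x) => {x} a; move: a; apply: span_additive.
move=> a [p [q [<- /contract_part aN]]].
by apply: mem_span; exists (p + 1), q; split=> //; lia.
Qed.

Lemma vertex_proj_part n x :
  x \in T_part K false n -> vertex_proj x \in chain_part K false n.
Proof.
move=> xT; have {xT} : val x \in N_sum K false (fun p q => q - p = n) by [].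
rewrite /vertex_proj /=; move: (val x) => a; move: a.
apply: span_additive => a [p [q [<-]]]; move: a.
apply: span_additive => _ [s [t [/andP[/eqP sp _] tq _ ->]]].
rewrite /= vertex_augE augE; case: eqVneq => [s1|_]; last by rewrite mulr0z rpred0.
rewrite -sp s1 subrr subr0; exact: chain_part_gen.
Qed.

Lemma vertex_section_part n b :
  b \in chain_part K false n -> vertex_section b \in T_part K false n.
Proof.
move: b; apply: span_additive => _ [s sn ->].
suff: contract (tens (osimplex K [::]) (osimplex K s)) \in
  N_sum K false (fun p q => q - p = n) by [].
have [|[_ ->]|[x [xs _ ->]]] // := @contract_simplexP _ K [::] s.
  exact: rpred0.
rewrite coneE; apply: mem_span; exists 0, n; split; first exact: subr0.
apply: mem_span; exists [:: x], s; split=> //; last by move=> y; rewrite inE => /eqP->.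
Qed.

(** The section is corrected by a power of the deformation, which turns it into a
    map of complexes without changing its composite with the retraction. *)
Lemma T_cochain_iso n :
  zmod_iso (homology (T_cochain K false) n) (homology (cochain_complex K false) n).
Proof.
pose g : {additive chains K -> N K false} := deformation false \o vertex_section.
have hp := @N_contract_part false.
have fp := vertex_proj_part.
have gp m b : b \in chain_part K false m -> g b \in T_part K false m.
  move=> bm; apply: (deform_part (X := T_cochain K false) hp).
  exact: vertex_section_part.
have fg m b : b \in chain_part K false m -> vertex_proj (g b) = b.
  by move=> bm; rewrite [LHS]vertex_proj_deformation (vertex_projK bm).
have gf x : g (vertex_proj x) = deformation false x.
  by rewrite [RHS]vertex_deformation_factor.
have fd : anticommuting (A := T_cochain K false) (B := cochain_complex K false)
  vertex_proj by move=> m x _; apply: vertex_proj_Delta.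
apply: (deformation_iso (X := T_cochain K false) (Y := cochain_complex K false)
  (f := vertex_proj) (g := g) fp gp hp fg gf n fd).
exact: (anticommuting_homotopy_inverse (X := T_cochain K false)
  (Y := cochain_complex K false) gp fg gf fd).
Qed.

Definition N_contract_dual r : {additive N_dual K r -> N_dual K r} :=
  precomp int (@N_contract r).

(** Transposition turns [h d] into [d h] and conversely, so the deformation of the
    dual complex is the transpose of the deformation. *)
Lemma dual_deformE r k (psi : N_dual K r) (x : N K r) :
  app (iter_add (deform (Delta_dual K r) (N_contract_dual r)) k psi) x =
  app psi (iter_add (deform (@Delta S K r) (@N_contract r)) k x).
Proof.
rewrite /iter_add; elim: k x => [//|k IH] x; rewrite [in RHS]iterSr -IH iterS.
move: (iter k _ psi) => phi; by rewrite /deform !(raddfB (app phi)) /= addrAC.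
Qed.

Lemma N_contract_dual_part r n psi : psi \in T_dual_part K r n ->
  N_contract_dual r psi \in T_dual_part K r (n - -1).
Proof.
move: psi; apply: span_additive => psi [p [q [<- /asboolP psiN]]].
apply: mem_span; exists (p - 1), q; split; first lia.
apply/asboolP => p' q' x pq /contract_part xN.
by apply: (psiN (p' + 1) q') => // -[pp qq]; apply: pq; congr (_, _); lia.
Qed.

Notation dual_deformation r :=
  (iter_add (deform (Delta_dual K r) (N_contract_dual r)) #|S|.+1).

(** The transpose of the retraction on cochains, after chains have been identified
    with functionals on cochains by the pairing. *)
Definition chain_functional (c : chains K) : N_dual K false :=
  precomp int vertex_proj (pairing c).
Lemma chain_functional_is_zmod_morphism : zmod_morphism chain_functional.
Proof. by move=> b c; rewrite /chain_functional !raddfB. Qed.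
HB.instance Definition _ := GRing.isZmodMorphism.Build (chains K) (N_dual K false)
  chain_functional chain_functional_is_zmod_morphism.

Definition functional_chain (psi : N_dual K false) : chains K :=
  \sum_(A in simplices K) basis K A *~ app psi (vertex_section (basis K A)).
Lemma functional_chain_is_zmod_morphism : zmod_morphism functional_chain.
Proof.
move=> phi psi; rewrite /functional_chain -sumrB; apply: eq_bigr => A _.
by rewrite -mulrzBr.
Qed.
HB.instance Definition _ := GRing.isZmodMorphism.Build (N_dual K false) (chains K)
  functional_chain functional_chain_is_zmod_morphism.

Lemma chain_functional_part n c : c \in chain_part K false n ->
  chain_functional c \in T_dual_part K false n.
Proof.
move: c; apply: span_additive => _ [s /andP[/eqP sn s0] ->].
apply: mem_span; exists 0, n; split; first exact: subr0.
apply/asboolP => p q x pq xN.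
rewrite -[LHS]/(app (pairing (osimplex K s)) (vertex_aug (val x))).
move: (val x) xN; apply: (@span_additive_eq _ _ _ (app _ \o @vertex_aug S K) \0).
move=> _ [u [v [/andP[/eqP up _] /andP[/eqP vq _] _ ->]]] /=.
rewrite vertex_augE augE raddfMz /= pairingE /pair_gen.
case: eqVneq => [u1|_]; last by rewrite mulr0z.
case: ifP => [/andP[/perm_size uv _]|_]; last by rewrite mul0rz.
by case: pq; rewrite -up -vq -sn u1 uv subrr.
Qed.

Lemma functional_chain_part n psi : psi \in T_dual_part K false n ->
  functional_chain psi \in chain_part K false n.
Proof.
move: psi; apply: span_additive => psi [p [q [<- /asboolP psiN]]].
apply: rpred_sum => A AK.
have [A0|A0] := eqVneq (enum A) [::].
  rewrite (_ : app psi _ = 0) ?mulr0z ?rpred0 //.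
  by rewrite /basis A0 vertex_section_nil raddf0.
have [x [xA _ hx]] : exists x, [/\ x \in enum A, {subset [:: x] <= enum A} &
    forall a, contract (tens a (basis K A)) = tens (cone x a) (basis K A)].
  by case: (@contract_simplexP _ K [::] (enum A)) => // -[A0' _]; rewrite A0' in A0.
pose q' : int := (size (enum A))%:Z - 1.
have Aq : has_dim false q' (enum A) by rewrite /has_dim eqxx A0.
have [[p0 q0]|pq] := pselect ((0 : int, q') = (p, q)).
  by apply: rpredMz; rewrite -p0 -q0 subr0; apply: chain_part_gen.
rewrite (psiN 0 q') ?mulr0z ?rpred0 //= hx coneE.
apply: mem_span; exists [:: x], (enum A); split=> //.
by move=> y; rewrite inE => /eqP->.
Qed.

Lemma functional_chain_pairing psi b :
  app (pairing (functional_chain psi)) b = app psi (vertex_section b).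
Proof.
rewrite pairingC raddf_sum -[in RHS](pairing_expand_l b) !raddf_sum.
by apply: eq_bigr => A _; rewrite !raddfMz /= !mulrzz mulrC.
Qed.

(** The transpose of the preceding equivalence. *)
Lemma T_chain_iso n :
  zmod_iso (homology (T_chain K false) n) (homology (chain_complex K false) n).
Proof.
pose f : {additive N_dual K false -> chains K} :=
  functional_chain \o dual_deformation false.
have hp := @N_contract_dual_part false.
have fp m psi : psi \in T_dual_part K false m -> f psi \in chain_part K false m.
  move=> psim; apply: functional_chain_part.
  exact: (deform_part (X := T_chain K false) hp).
have gp := chain_functional_part.
have fg m c : c \in chain_part K false m -> f (chain_functional c) = c.
  move=> cm; rewrite -[LHS]pairing_expand_l -[RHS]pairing_expand_l.
  apply: eq_bigr => A _; congr (_ *~ _).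
  rewrite functional_chain_pairing dual_deformE.
  (* The functional of c factors through the retraction, which the deformation
     preserves. *)
  transitivity (app (pairing c) (vertex_proj (vertex_section (basis K A)))).
    by rewrite -[in RHS]vertex_proj_deformation.
  have [A0|A0] := eqVneq (enum A) [::]; last first.
    rewrite (@vertex_projK ((size (enum A))%:Z - 1)) //.
    by rewrite chain_part_gen // /has_dim eqxx.
  rewrite /basis A0 vertex_section_nil raddf0 raddf0 pairingC.
  move: c cm; apply: (@span_additive_eq _ _ _ \0 (app _)) => _ [s /andP[_ s0] ->] /=.
  by rewrite pairingE /pair_gen perm_sym; case: perm_nilP s0 => [->|].
have gf psi : chain_functional (f psi) = dual_deformation false psi.
  apply: homP => x; rewrite dual_deformE vertex_deformation_factor -dual_deformE.
  exact: functional_chain_pairing.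
have gd : anticommuting (A := chain_complex K false) (B := T_chain K false)
  chain_functional.
  move=> m c _; apply: homP => x.
  transitivity (- app (pairing c) (vertex_proj (Delta x))) => //.
  rewrite vertex_proj_Delta raddfN opprK.
  rewrite -[LHS]/(app (pairing (boundary false c)) (vertex_proj x)).
  apply: (vertex_proj_additive_eq (f := app _) (g := app _ \o @coboundary S K)) => s.
  exact: pairing_boundary_false.
apply: (deformation_iso (X := T_chain K false) (Y := chain_complex K false)
  (f := f) (g := chain_functional) fp gp hp fg gf n _ gd).
exact: (anticommuting_homotopy_retraction (X := T_chain K false)
  (Y := chain_complex K false) fp fg gf gd).
Qed.

End Equivalence.

(** * The reduced case *)

Definition point_part (n : int) : {pred int} := fun m => (n == 0) || (m == 0).

Lemma point_part_zmod_closed n : zmod_closed (point_part n).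
Proof.
split=> [|x y]; rewrite !unfold_in /point_part ?eqxx ?orbT //.
by case: (n == 0) => //= /eqP-> /eqP->; rewrite subrr.
Qed.
HB.instance Definition _ n :=
  GRing.isZmodClosed.Build int (point_part n) (@point_part_zmod_closed n).

Lemma point_diff_part e n (x : int) :
  x \in point_part n -> (\0 : {additive int -> int}) x \in point_part (n + e).
Proof. by move=> _; apply: (rpred0 (point_part (n + e))). Qed.

(** The group of integers in degree 0 with zero differential: the target of the
    reduced equivalences. *)
Definition point_complex (e : int) : complex e :=
  @Complex e int point_part \0 (@point_diff_part e) (fun _ => erefl).

Lemma homology_point e : zmod_iso (homology (point_complex e) 0) int.
Proof.
have H0 z : z \in is_boundary (point_complex e) 0 -> (val z : int) = 0.
  by move=> /asboolP[y _ ->].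
apply: (@zmod_iso_bij _ _ (quot_lift (f := val) H0)) => [a|b].
  have := quot_liftE (f := val) H0 (repr a); rewrite proj_repr => aE a0.
  rewrite -(proj_repr a) (_ : repr a = 0) ?raddf0 //.
  apply: val_inj; exact: etrans (esym aE) a0.
have bZ : b \in is_cycle (point_complex e) 0 by apply/andP; split.
exists (proj (is_boundary _ _) (exist _ b bZ : cycles (point_complex e) 0)).
exact: (quot_liftE (f := val) H0).
Qed.

Lemma homology_point_eq0 e n : n != 0 ->
  forall a : homology (point_complex e) n, a = 0.
Proof.
move=> n0 a; rewrite -(proj_repr a) (_ : repr a = 0) ?raddf0 //.
apply: val_inj; have /andP[+ _] := valP (repr a).
by rewrite unfold_in /= /point_part (negPf n0) => /eqP.
Qed.

Lemma dsum_homology_point e (X : complex e) :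
  (forall n, zmod_iso (homology X n) (homology (point_complex e) n)) ->
  zmod_iso (dsum (fun n => homology X n)) int.
Proof.
move=> Xpt; have X0 n : n != 0 -> forall a : homology X n, a = 0.
  move=> n0; apply: zmod_iso_trivial (Xpt n) _; exact: homology_point_eq0.
apply: zmod_iso_trans (dsum_concentrated X0) _.
exact: zmod_iso_trans (Xpt 0) (homology_point e).
Qed.

Section Reduced.
Variables (S : finType) (K : simplicial_complex S).

Notation deformation :=
  (iter_add (deform (@Delta S K true) (@N_contract S K true)) #|S|.+1).
Notation dual_deformation :=
  (iter_add (deform (Delta_dual K true) (N_contract_dual K true)) #|S|.+1).

Definition empty_proj : {additive N K true -> int} := @empty_aug S K \o val.

Lemma empty_gen_part :
  tens (osimplex K [::]) (osimplex K [::]) \in N_part K true (-1) (-1).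
Proof. by apply: mem_span; exists [::], [::]. Qed.

Lemma empty_gen_subproof :
  tens (osimplex K [::]) (osimplex K [::]) \in N_total K true.
Proof. by apply: mem_span; exists (-1), (-1); split=> //; apply: empty_gen_part. Qed.

(** The survivor of the contraction in the reduced case; it is not a cocycle in
    general, and the deformation corrects it to one. *)
Definition empty_gen : N K true :=
  exist _ (tens (osimplex K [::]) (osimplex K [::])) empty_gen_subproof.

Definition empty_section : {additive int -> N K true} := *~%R empty_gen.

Lemma empty_proj_contract x : empty_proj (N_contract x) = 0.
Proof. exact: empty_aug_contract (valP x). Qed.

Lemma empty_proj_cobd x : empty_proj (N_cobd x) = 0.
Proof. exact: empty_aug_coboundary. Qed.

Lemma empty_proj_contract_cobd x : empty_proj (N_cobd (N_contract x)) = 0.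
Proof. exact: empty_proj_cobd. Qed.

Lemma empty_contract_bd (x : N K true) :
  N_bd (N_contract x) + N_contract (N_bd x) = x - empty_section (empty_proj x).
Proof.
apply: val_inj; rewrite raddfB raddfMz.
exact: contract_boundary_true (valP x).
Qed.

Lemma empty_projK m : empty_proj (empty_section m) = m.
Proof. by rewrite raddfMz /= empty_augE augE mulr1 intz. Qed.

Lemma empty_proj_deformation x : empty_proj (deformation x) = empty_proj x.
Proof.
exact: (p_deformation empty_proj_contract empty_proj_contract_cobd
  empty_contract_bd (fun x => empty_projK _)).
Qed.

Lemma empty_deformation_factor x :
  deformation x = deformation (empty_section (empty_proj x)).
Proof.
exact: (deformation_factor empty_proj_contract empty_proj_contract_cobd
  empty_contract_bd (fun x => empty_projK _)).
Qed.

Lemma empty_proj_Delta x : empty_proj (Delta x) = 0.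
Proof.
rewrite /Delta raddfD /= [X in _ + X]empty_proj_cobd addr0.
exact: empty_aug_boundary (valP x).
Qed.

Lemma empty_aug_part p q a : (p, q) <> (-1 : int, -1 : int) ->
  a \in N_part K true p q -> empty_aug a = 0.
Proof.
move=> pq; apply: (span_additive_eq (f := @empty_aug S K) (g := \0)).
move=> _ [s [t [/andP[/eqP sp _] /andP[/eqP tq _] _ ->]]] /=.
rewrite empty_augE !augE /=; case: eqVneq => [s0|]; last by rewrite mul0r.
case: eqVneq => [t0|]; last by rewrite mulr0.
by case: pq; rewrite -sp -tq s0 t0.
Qed.

Lemma empty_proj_part n x : x \in T_part K true n -> empty_proj x \in point_part n.
Proof.
move=> xT; rewrite unfold_in /point_part; case: eqVneq => //= n0.
have {xT} : val x \in N_sum K true (fun p q => q - p = n) by [].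
rewrite /empty_proj /= => xT; apply/eqP; move: (val x) xT.
apply: (span_additive_eq (f := @empty_aug S K) (g := \0)) => a [p [q [pq aN]]].
apply: empty_aug_part aN => -[p1 q1]; by rewrite -pq p1 q1 subrr eqxx in n0.
Qed.

Lemma empty_section_part n m :
  m \in point_part n -> empty_section m \in T_part K true n.
Proof.
rewrite unfold_in /point_part => /predU1P[->|/eqP->]; last first.
  by rewrite raddf0 rpred0.
apply: rpredMz.
suff : tens (osimplex K [::]) (osimplex K [::]) \in
  N_sum K true (fun p q => q - p = 0) by [].
by apply: mem_span; exists (-1), (-1); split=> //; apply: empty_gen_part.
Qed.

Lemma T_cochain_point_iso n :
  zmod_iso (homology (T_cochain K true) n) (homology (point_complex 1) n).
Proof.
pose g : {additive int -> N K true} := deformation \o empty_section.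
have hp := @N_contract_part S K true.
have fp := empty_proj_part.
have gp m b : b \in point_part m -> g b \in T_part K true m.
  move=> bm; apply: (deform_part (X := T_cochain K true) hp).
  exact: empty_section_part.
have fg m b : b \in point_part m -> empty_proj (g b) = b.
  by move=> _; rewrite [LHS]empty_proj_deformation empty_projK.
have gf x : g (empty_proj x) = deformation x by rewrite [RHS]empty_deformation_factor.
have fd : anticommuting (A := T_cochain K true) (B := point_complex 1) empty_proj.
  by move=> m x _; rewrite [LHS]empty_proj_Delta oppr0.
apply: (deformation_iso (X := T_cochain K true) (Y := point_complex 1)
  (f := empty_proj) (g := g) fp gp hp fg gf n fd).
exact: (anticommuting_homotopy_inverse (X := T_cochain K true)
  (Y := point_complex 1) gp fg gf fd).
Qed.

Definition empty_functional : {additive int -> N_dual K true} :=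
  *~%R (Defs.hom empty_proj).

Lemma empty_functionalE m x : app (empty_functional m) x = empty_proj x * m.
Proof.
pose ev : N_dual K true -> int := fun phi => app phi x.
have evB : zmod_morphism ev by [].
pose f : {additive N_dual K true -> int} :=
  HB.pack ev (GRing.isZmodMorphism.Build _ _ _ evB).
by rewrite -[LHS]/(f _) raddfMz mulrzz.
Qed.

Lemma T_chain_point_iso n :
  zmod_iso (homology (T_chain K true) n) (homology (point_complex (-1)) n).
Proof.
pose ev : N_dual K true -> int := fun phi => app phi empty_gen.
have evB : zmod_morphism ev by [].
pose eva : {additive N_dual K true -> int} :=
  HB.pack ev (GRing.isZmodMorphism.Build _ _ _ evB).
pose f : {additive N_dual K true -> int} := eva \o dual_deformation.
have hp := @N_contract_dual_part S K true.
have evp m psi : psi \in T_dual_part K true m -> eva psi \in point_part m.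
  rewrite unfold_in /point_part; case: eqVneq => //= m0 psim; apply/eqP.
  move: psi psim; apply: (span_additive_eq (f := eva) (g := \0)).
  move=> psi [p [q [pq /asboolP psiN]]].
  apply: (psiN (-1) (-1)); last exact: empty_gen_part.
  by move=> [p1 q1]; rewrite -pq -p1 -q1 subrr eqxx in m0.
have fp m psi : psi \in T_dual_part K true m -> f psi \in point_part m.
  move=> psim; apply: evp; exact: (deform_part (X := T_chain K true) hp).
have gp m b : b \in point_part m -> empty_functional b \in T_dual_part K true m.
  rewrite unfold_in /point_part => /predU1P[->|/eqP->]; last by rewrite raddf0 rpred0.
  apply: rpredMz; apply: mem_span; exists (-1), (-1); split=> //.
  apply/asboolP => p q x pq; exact: empty_aug_part.
have fg m b : b \in point_part m -> f (empty_functional b) = b.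
  move=> _; rewrite [LHS]dual_deformE empty_functionalE empty_proj_deformation.
  by rewrite -[empty_gen]/(empty_section 1) empty_projK mul1r.
have gf psi : empty_functional (f psi) = dual_deformation psi.
  apply: homP => x; rewrite empty_functionalE [RHS]dual_deformE.
  rewrite empty_deformation_factor !raddfMz mulrzz mulrC; congr (_ * _).
  exact: dual_deformE.
have gd : anticommuting (A := point_complex (-1)) (B := T_chain K true)
  empty_functional.
  move=> m b _; rewrite raddf0; apply: homP => x.
  transitivity (- app (empty_functional b) (Delta x)) => //.
  by rewrite empty_functionalE empty_proj_Delta mul0r oppr0.
apply: (deformation_iso (X := T_chain K true) (Y := point_complex (-1))
  (f := f) (g := empty_functional) fp gp hp fg gf n _ gd).
exact: (anticommuting_homotopy_retraction (X := T_chain K true)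
  (Y := point_complex (-1)) fp fg gf gd).
Qed.
End Reduced.

Theorem proposition3p3 (S : finType) (K : simplicial_complex S) :
  (forall n : int, zmod_iso (homology (T_cochain K false) n)
                            (homology (cochain_complex K false) n)) /\
  (forall n : int, zmod_iso (homology (T_chain K false) n)
                            (homology (chain_complex K false) n)) /\
  zmod_iso (dsum (fun n : int => homology (T_cochain K true) n)) int /\
  zmod_iso (dsum (fun n : int => homology (T_chain K true) n)) int.
Proof.
split; first exact: T_cochain_iso.
split; first exact: T_chain_iso.
split; apply: dsum_homology_point => n.
  exact: T_cochain_point_iso.
exact: T_chain_point_iso.
Qed.
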